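(* Let $p$ be a monic hyperbolic polynomial of degree $d\ge2$ with connected Julia set. There exists $a_0>0$ such that if $0<|a|<a_0$ then, with $f^*:\mathbb{S}^1\times\mathbb{D}_r\to J^+\cap V$, $f^*(t,z)=(\varphi_t(z),z)$, the fixed point of the graph transform associated to $H_{p,a}$, and $\sigma:\mathbb{S}^1\times\mathbb{D}_r\to\mathbb{S}^1\times\mathbb{D}_r$ given by $\sigma(t,z)=(dt,\,a\varphi_t(z))$, the diagram with horizontal maps $f^*$ and vertical maps $\sigma$ and $H_{p,a}:J^+\cap V\to J^+\cap V$ commutes: $$H_{p,a}\circ f^*=f^*\circ\sigma\quad\text{on }\mathbb{S}^1\times\mathbb{D}_r.$$
   Context: Hénon map: $H(x,y)=H_{p,a}(x,y)=(p(x)+ay,ax)$, $0<|a|<1$. $K^{\pm}$ are the sets of points with bounded forward/backward orbit, $J^\pm=\partial K^\pm$, $J=J^+\cap J^-$, $U^+=\mathbb{C}^2\setminus K^+$. The sets $U,U'$: $J_p$ and $K_p$ are the Julia and filled Julia set of $p$; $\psi_p:\mathbb{C}\setminus\overline{\mathbb{D}}\to\mathbb{C}\setminus K_p$ is the conformal isomorphism with $\psi_p(z^d)=p(\psi_p(z))$ and $\psi_p(z)/z\to1$ at $\infty$. For each attracting cycle of $p$ take a union $V_i$ of small disks around the points of the cycle, contained in the immediate basin, with $p(V_i)$ relatively compact in $V_i$; $\Delta=\bigcup_iV_i$; $N\ge0$ is minimal such that $p^{-N}(\Delta)$ contains all critical values of $p$. For large $R>1$, $U=\mathbb{C}\setminus\big(\overline{p^{-N}(\Delta)}\cup\{z\in\mathbb{C}\setminus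 K_p:|\psi_p^{-1}(z)|\ge R\}\big)$ and $U'=p^{-1}(U)$, relatively compact in $U$. $d_U$ is the Poincaré distance of $U$. The set $V$: $\mathbb{D}_r=\{|y|<r\}$, $V=U'\times\mathbb{D}_r$, where $r>3$ and $R$ are large constants independent of $a$, and $|a|$ is small, so that: $|ax|<r$ for $x\in U'$; $J\subset V$; $\partial\mathbb{D}_r\subset U'$ and all points of $H(V)\setminus(\overline{\mathbb{D}_r}\times\overline{\mathbb{D}_r})$ lie in $U^+$; $r|a|<\inf_{U'}|p'|$; $r|a|<\mathrm{dist}(\partial U',\partial U)$. Vertical-like disks: the graph $\{(\varphi(z),z):z\in\mathbb{D}_r\}$ of a holomorphic $\varphi:\mathbb{D}_r\to U'$ is vertical-like if each nonzero tangent vector $(\xi,\eta)$ to it at each of its points $(x,y)$ satisfies $|\xi|<|\eta|$ and $|(x,\xi)|_U<|(y,\eta)|_{\mathbb{D}_r}$ (lengths in the Poincaré metrics of $U$ and $\mathbb{D}_r$). For $|a|$ small, the preimage under $H$ of a vertical-like disk, intersected with $V$, is a union of $d$ vertical-like disks. The fixed point $f^*$: with $\mathbb{S}^1=\mathbb{R}/\mathbb{Z}$, let $\gamma_n(t)=\psi_p(R^{1/d^{n+1}}e^{2\pi it})$ and $f_0(t,z)=(\gamma_0(t),z)$ (the outer boundary of $V$). $f_1(t,\cdot)$ parametrizes, as a graph over the second coordinate, the component of $H^{-1}(f_0(dt\times\mathbb{D}_r))\cap V$ through $(\gamma_1(t),0)$. Choose a homotopy $R_0(s,z)$, $s\in[0,1]$,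 of vertical-like disks from $f_0(0,\cdot)$ to $f_1(0,\cdot)$ with $R_0(s,0)$ on the external ray of $p$ of angle $0$; inductively $R_n(s,\cdot)$ is the continuous family of vertical-like disks, parametrized over the second coordinate, with $R_n(s\times\mathbb{D}_r)$ a component of $H^{-1}(R_{n-1}(s\times\mathbb{D}_r))\cap V$ and $R_n(0,\cdot)=R_{n-1}(1,\cdot)$. For $n\ge1$, $f_{n+1}=F(f_n)$ (graph transform) is the map, continuous in $t$, such that $f_{n+1}(t,z)=(\varphi_t^{n+1}(z),z)$ parametrizes over the second coordinate one of the $d$ components of $H^{-1}(f_n(dt\times\mathbb{D}_r))\cap V$, normalized by $f_{n+1}(0,\cdot)=R_n(1,\cdot)$. For $|a|$ small, $F$ is a contraction for $d(f,g)=\sup_{t,z}d_U(pr_1f(t,z),pr_1g(t,z))$, and $f^*=\lim_n f_n$ is its fixed point; $f^*(t,z)=(\varphi_t(z),z)$ with $\varphi_t(z)$ continuous in $t$ and holomorphic in $z$. *)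

(* Defs.v *)
From HB Require Import structures.
From mathcomp Require Import all_boot all_order all_algebra.
From mathcomp Require Import all_classical all_reals all_analysis.
From mathcomp Require Import complex.
Set Implicit Arguments.
Unset Strict Implicit.
Unset Printing Implicit Defensive.
Import Order.TTheory GRing.Theory Num.Theory.
Import numFieldNormedType.Exports.
Export numFieldNormedType.Exports.
Local Open Scope classical_set_scope.
Local Open Scope ring_scope.
Local Open Scope complex_scope.

(* [R[i]] is packaged as a numClosedFieldType because the topology and the
   normed module structure over itself, hence complex differentiability, are
   attached by the library to abstract number fields and not to [R[i]]. *)
Definition CC (R : realType) : numClosedFieldType := R[i].

Section Definitions.
Variable R : realType.
Local Notation C := (CC R).

(** The real-valued modulus; the library norm of [C] takes its values in [C]. *)
Definition modulus (z : C) : R := ComplexField.Normc.normc z.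

Definition disc (c : C) (r : R) : set C := [set z | modulus (z - c) < r].

Definition frontier (T : topologicalType) (A : set T) : set T :=
  closure A `\` interior A.

Definition relatively_compact_in (T : topologicalType) (A B : set T) : Prop :=
  compact (closure A) /\ closure A `<=` B.

(** [derivable] over the field [C] is complex differentiability; this is used
    only for open [A]. *)
Definition holomorphic_on (A : set C) (f : C -> C) : Prop :=
  forall z, A z -> derivable f z 1.

Definition cderiv (f : C -> C) (z : C) : C := derive1 f z.

Section PolynomialDynamics.
Variable p : {poly C}.

Definition piter (n : nat) (z : C) : C := iter n (horner p) z.

Definition filled_julia : set C :=
  [set z | exists M : R, forall n, modulus (piter n z) <= M].

Definition julia : set C := frontier filled_julia.

Definition critical_point : set C := [set c | root (p^`()) c].

Definition critical_value : set C := horner p @` critical_point.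

(** Points of attracting cycles (superattracting ones included). *)
Definition attracting : set C :=
  [set z | exists k, [/\ (0 < k)%N, piter k z = z &
                      modulus (cderiv (piter k) z) < 1]].

(** Basin of the whole cycle of the periodic point [z]. *)
Definition basin (z : C) : set C :=
  [set w | exists j, (fun n => modulus (piter n w - piter (n + j) z))
                     @ \oo --> (0 : R)].

Definition immediate_basin (z : C) : set C :=
  \bigcup_j connected_component (basin z) (piter j z).

(** Every critical point is attracted by an attracting cycle, possibly the
    point at infinity. *)
Definition hyperbolic : Prop :=
  forall c, critical_point c ->
    ((fun n => modulus (piter n c)) @ \oo --> +oo) \/
    (exists2 z, attracting z & basin z c).

(** [psi] is the conformal isomorphism from the exterior of the closed unit
    disk onto the complement of [filled_julia], and [chi] its inverse. *)
Definition exterior : set C := [set z | 1 < modulus z].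

Record bottcher (psi chi : C -> C) : Prop := Bottcher {
  bottcher_holo : holomorphic_on exterior psi;
  bottcher_inv_holo : holomorphic_on (~` filled_julia) chi;
  bottcher_maps : forall z, exterior z -> (~` filled_julia) (psi z);
  bottcher_inv_maps : forall z, (~` filled_julia) z -> exterior (chi z);
  bottcherK : forall z, exterior z -> chi (psi z) = z;
  bottcher_invK : forall z, (~` filled_julia) z -> psi (chi z) = z;
  bottcher_conj : forall z, exterior z ->
    psi (z ^+ (size p).-1) = p.[psi z];
  bottcher_infty : forall e : R, 0 < e -> exists M : R,
    forall z, M < modulus z -> modulus (psi z / z - 1) < e }.

(** The disks making up the sets V_i are centered at the points [z] of the
    attracting cycles, with radius [eps z]; [cycle_nbhd eps z] is the V_i of
    the cycle of [z]. *)
Definition cycle_nbhd (eps : C -> R) (z : C) : set C :=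
  \bigcup_j disc (piter j z) (eps (piter j z)).

Definition trapping_radii (eps : C -> R) : Prop :=
  forall z, attracting z ->
    [/\ 0 < eps z,
        cycle_nbhd eps z `<=` immediate_basin z &
        relatively_compact_in (horner p @` cycle_nbhd eps z)
                              (cycle_nbhd eps z)].

Definition Delta (eps : C -> R) : set C :=
  \bigcup_(z in attracting) disc z (eps z).

Definition minimal_level (eps : C -> R) (N : nat) : Prop :=
  critical_value `<=` piter N @^-1` Delta eps /\
  forall M, critical_value `<=` piter M @^-1` Delta eps -> (N <= M)%N.

(** [Rad] is the constant written R in the mathematics. *)
Definition domU (eps : C -> R) (N : nat) (chi : C -> C) (Rad : R) : set C :=
  ~` (closure (piter N @^-1` Delta eps) `|`
      [set z | (~` filled_julia) z /\ Rad <= modulus (chi z)]).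

Definition domU' (eps : C -> R) (N : nat) (chi : C -> C) (Rad : R) : set C :=
  horner p @^-1` domU eps N chi Rad.

End PolynomialDynamics.

(** Poincare metrics, normalized to curvature -1. *)

Definition disc_density (r : R) (z : C) : R :=
  2 * r / (r ^+ 2 - modulus z ^+ 2).

(** Holomorphic covering of [U] by the unit disk. The sheets over [W] form the
    set [F]; each is open and projects homeomorphically onto [W]. *)
Definition holomorphic_covering (U : set C) (pi : C -> C) : Prop :=
  [/\ holomorphic_on (disc 0 1) pi, pi @` disc 0 1 = U &
   forall x, U x -> exists W : set C,
    [/\ open W, W x, W `<=` U & exists F : set (set C),
     [/\ disc 0 1 `&` pi @^-1` W = \bigcup_(O in F) O,
         forall O1 O2, F O1 -> F O2 -> O1 `&` O2 !=set0 -> O1 = O2 &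
         forall O, F O -> open O /\ exists s : C -> C,
          [/\ forall w, W w -> {for w, continuous s},
              forall w, W w -> O (s w) /\ pi (s w) = w &
              forall u, O u -> s (pi u) = u]]]].

(** [rho] is the density of the Poincare metric of [U], i.e. |(x,xi)|_U is
    [rho x * modulus xi]: the universal covering by the unit disk is a local
    isometry. *)
Definition poincare_density (U : set C) (rho : C -> R) : Prop :=
  exists2 pi : C -> C, holomorphic_covering U pi &
    forall w, disc 0 1 w ->
      rho (pi w) * modulus (cderiv pi w) = disc_density 1 w.

Definition C1 (x : R -> R) : Prop :=
  (forall t, derivable x t 1) /\ continuous (derive1 x).

Definition path_length (rho : C -> R) (x y : R -> R) : \bar R :=
  (\int[lebesgue_measure]_(t in `[0%R, 1%R])
    (rho (x t +i* y t)
      * Num.sqrt (derive1 x t ^+ 2 + derive1 y t ^+ 2))%:E)%E.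

Definition poincare_dist (U : set C) (rho : C -> R) (z w : C) : \bar R :=
  ereal_inf [set l | exists x y : R -> R,
    [/\ C1 x, C1 y, x 0 +i* y 0 = z, x 1 +i* y 1 = w &
        (forall t, 0 <= t <= 1 -> U (x t +i* y t)) /\
        l = path_length rho x y]].

(** Henon maps. *)

Definition henon (p : {poly C}) (a : C) (v : C * C) : C * C :=
  (p.[v.1] + a * v.2, a * v.1).

Definition Kplus (p : {poly C}) (a : C) : set (C * C) :=
  [set v | exists M : R, forall n,
    modulus (iter n (henon p a) v).1 <= M /\
    modulus (iter n (henon p a) v).2 <= M].

Definition Jplus (p : {poly C}) (a : C) : set (C * C) :=
  frontier (Kplus p a).

Definition domV (U' : set C) (r : R) : set (C * C) := U' `*` disc 0 r.

(** The vertical disk parametrized, over the second coordinate, by [phi]. *)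
Definition graph (r : R) (phi : C -> C) : set (C * C) :=
  [set (phi z, z) | z in disc 0 r].

(** The tangent vectors to the graph at [(phi z, z)] are the
    [(cderiv phi z * eta, eta)]. *)
Definition vertical_like (U' : set C) (rho : C -> R) (r : R)
    (phi : C -> C) : Prop :=
  [/\ holomorphic_on (disc 0 r) phi,
      forall z, disc 0 r z -> U' (phi z) &
      forall z, disc 0 r z -> forall xi eta : C,
        xi = cderiv phi z * eta -> (xi, eta) != (0, 0) ->
        modulus xi < modulus eta /\
        rho (phi z) * modulus xi < disc_density r z * modulus eta].

(** The graph of [phi'] is the connected component through [v] of
    H^-1(graph of [phi]) intersected with V. *)
Definition pullback_component_at (p : {poly C}) (a : C) (U' : set C) (r : R)
    (phi phi' : C -> C) (v : C * C) : Prop :=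
  let A := henon p a @^-1` graph r phi `&` domV U' r in
  A v /\ graph r phi' = connected_component A v.

Definition pullback_component (p : {poly C}) (a : C) (U' : set C) (r : R)
    (phi phi' : C -> C) : Prop :=
  exists v, pullback_component_at p a U' r phi phi' v.

Definition expi (t : R) : C := cos (2 * pi * t) +i* sin (2 * pi * t).

Definition gamma (p : {poly C}) (psi : C -> C) (Rad : R) (n : nat) (t : R) : C :=
  psi ((Rad `^ (((size p).-1 ^ n.+1)%N%:R^-1))%:C * expi t).

(** The external ray of angle 0. *)
Definition ray0 (psi : C -> C) : set C := [set psi (s%:C) | s in [set s | 1 < s]].

(** The circle R/Z is represented by 1-periodic functions on [R]. *)
Definition circle_map (r : R) (f : R -> C -> C) : Prop :=
  forall t z, disc 0 r z -> f (t + 1) z = f t z.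

Definition strip (r : R) : set (R * C) :=
  [set q | 0 <= q.1 <= 1 /\ disc 0 r q.2].

(** The iterates of the graph transform: f_n(t,z) = [(f n t z, z)] and
    R_n(s,z) = [(h n s z, z)]. The disk R_0(0,.) = f_0(0,.) lies over the
    boundary of [U'], hence vertical-likeness of R_0(s,.) is asked for s > 0. *)
Record graph_transform_iterates (p : {poly C}) (a : C) (psi : C -> C)
    (Rad : R) (U' : set C) (rho : C -> R) (r : R)
    (f h : nat -> R -> C -> C) : Prop := GraphTransformIterates {
  gt_circle : forall n, circle_map r (f n);
  gt_f0 : forall t z, disc 0 r z -> f 0%N t z = gamma p psi Rad 0 t;
  gt_f1 : forall t,
    pullback_component_at p a U' r (f 0%N ((size p).-1%:R * t)) (f 1%N t)
      (gamma p psi Rad 1 t, 0);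
  gt_vertical : forall n t, vertical_like U' rho r (f n.+1 t);
  gt_h0_vertical : forall s, 0 < s <= 1 -> vertical_like U' rho r (h 0%N s);
  gt_h0_left : forall z, disc 0 r z -> h 0%N 0 z = f 0%N 0 z;
  gt_h0_right : forall z, disc 0 r z -> h 0%N 1 z = f 1%N 0 z;
  gt_h0_ray : forall s, 0 <= s <= 1 -> ray0 psi (h 0%N s 0);
  gt_h_cont : forall n, {within strip r, continuous (fun q => h n q.1 q.2)};
  gt_h_vertical : forall n s, 0 <= s <= 1 -> vertical_like U' rho r (h n.+1 s);
  gt_h_pullback : forall n s, 0 <= s <= 1 ->
    pullback_component p a U' r (h n s) (h n.+1 s);
  gt_h_glue : forall n z, disc 0 r z -> h n.+1 0 z = h n 1 z;
  gt_f_cont : forall n z, disc 0 r z -> continuous (fun t => f n.+2 t z);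
  gt_f_pullback : forall n t,
    pullback_component p a U' r (f n.+1 ((size p).-1%:R * t)) (f n.+2 t);
  gt_f_normalized : forall n z, disc 0 r z -> f n.+2 0 z = h n.+1 1 z }.

(** The distance on families of vertical disks for which the graph transform
    is a contraction. *)
Definition family_dist (U : set C) (rho : C -> R) (r : R)
    (f g : R -> C -> C) : \bar R :=
  ereal_sup [set l | exists t z,
    disc 0 r z /\ l = poincare_dist U rho (f t z) (g t z)].

(** f*(t,z) = [(phi t z, z)] is the limit of the iterates of the graph
    transform. *)
Definition graph_transform_fixed_point (p : {poly C}) (a : C) (psi : C -> C)
    (Rad : R) (U U' : set C) (rho : C -> R) (r : R)
    (phi : R -> C -> C) : Prop :=
  [/\ circle_map r phi,
      forall t z, disc 0 r z -> U (phi t z) &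
      exists f h, graph_transform_iterates p a psi Rad U' rho r f h /\
        (family_dist U rho r (f n) phi @[n --> \oo] --> 0%E)].

Definition fstar (phi : R -> C -> C) (q : R * C) : C * C := (phi q.1 q.2, q.2).

Definition sigma (d : nat) (a : C) (phi : R -> C -> C) (q : R * C) : R * C :=
  (d%:R * q.1, a * phi q.1 q.2).

End Definitions.

(* Main.v *)
Require Import Defs.
From HB Require Import structures.
From mathcomp Require Import all_boot all_order all_algebra.
From mathcomp Require Import all_classical all_reals all_analysis.
From mathcomp Require Import complex measurable_realfun ring lra zify.
Import Order.TTheory GRing.Theory Num.Theory.
Import numFieldNormedType.Exports.
Local Open Scope classical_set_scope.
Local Open Scope ring_scope.

(**
Writing [f_n(t, z) = (f n t z, z)], the pullback condition reads
[p (f n.+1 t z) + a z = f n (d t) (a (f n.+1 t z))]. Since vertical-like disks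
are uniformly Lipschitz, pointwise convergence [f n -> phi] suffices to pass to
the limit, and the limit equation is the commutation of the diagram. Pointwise
convergence follows from convergence in the Poincaré distance because [U] is
bounded, so that the Cauchy estimate for the universal covering bounds the
Poincaré density of [U] from below.

For [|a|] small, a point [(x, y)] with [|y| < r] and [x] outside [U'] is not in
[J+]: either [p x] escapes under [p], and the Hénon map shadows [p] for long
enough to escape too, or [p x] is in the closure of [p^-N(Delta)] and the orbit
is trapped over [Delta]. The graph of [phi] is in [K+] since its forward orbits
stay in a bounded set, and it is a limit of the graphs of [f n], which are
mapped into the escaping outer boundary of [V]; so it is in [J+], hence in [V].

The trapping uses a uniform margin, for which the attracting cycles must be
finite in number. This is Fatou's theorem: if no critical point is attracted
by the cycle of [z], Ahlfors' maximum principle applied to the iterates of [p]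
on the preimages of a disk about [z] bounds their derivatives at [z] from
below, although these derivatives tend to 0.
*)

(** * Complex modulus *)

Section Modulus.
Context {R : realType}.
Implicit Types z w : CC R.

(** For n >= 1 the [f n] take values in [U'], but their limit [phi] is only known to lie in the
    larger [U]. Membership in V is therefore recovered through J+, which is why J+ has to be located
    over [U'] at all. The threshold on |a| is fixed before [a] and [phi], so each smallness
    condition must come from [p], [eps], [N], [Rad] and [r] alone. Sharp constants are irrelevant,
    because only some positive lower bound of the density is wanted. Hence the Cauchy estimate may
    be proved on squares, with 12 in place of 1, from the imaginary part of the integral of F dz.
    Fatou's theorem is usually proved by continuing an inverse branch of the iterates. The maximum
    principle is applied instead to the iterate itself, a polynomial: no branch is constructed, and
    the conditions at the maximum involve only its Taylor coefficients of order at most 3. *)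

Definition tc (x : R) : CC R := (x%:C)%C.

Lemma normCE z : `|z| = tc (modulus z).
Proof. by []. Qed.

Lemma modulus_ge0 z : 0 <= modulus z.
Proof. by case: z => a b; exact: sqrtr_ge0. Qed.

Lemma modulusD z w : modulus (z + w) <= modulus z + modulus w.
Proof. exact: le_normcD. Qed.

Lemma modulusN z : modulus (- z) = modulus z.
Proof. exact: normcN. Qed.

Lemma modulusM z w : modulus (z * w) = modulus z * modulus w.
Proof. exact: ComplexField.Normc.normcM. Qed.

Lemma modulusV z : modulus z^-1 = (modulus z)^-1.
Proof. exact: ComplexField.Normc.normcV. Qed.

Lemma modulus0 : modulus (0 : CC R) = 0.
Proof. exact: ComplexField.Normc.normc0. Qed.

Lemma modulus1 : modulus (1 : CC R) = 1.
Proof. exact: ComplexField.Normc.normc1. Qed.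

Lemma modulus_eq0 z : modulus z = 0 -> z = 0.
Proof. exact: ComplexField.Normc.eq0_normc. Qed.

Lemma modulus_gt0 z : (0 < modulus z) = (z != 0).
Proof.
rewrite lt_def modulus_ge0 andbT; congr (~~ _).
by apply/eqP/eqP => [/modulus_eq0 //|->]; exact: modulus0.
Qed.

Lemma modulusX z n : modulus (z ^+ n) = modulus z ^+ n.
Proof.
by elim: n => [|n IH]; rewrite ?expr0 ?modulus1// !exprS modulusM IH.
Qed.

Lemma modulus_tc (x : R) : modulus (tc x) = `|x|.
Proof. by rewrite /modulus /= expr0n /= addr0 sqrtr_sqr. Qed.

Lemma modulusB z w : modulus (z - w) = modulus (w - z).
Proof. by rewrite -modulusN opprB. Qed.

Lemma modulus_triB z w u : modulus (z - u) <= modulus (z - w) + modulus (w - u).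
Proof. by rewrite (le_trans _ (modulusD _ _))// addrA subrK. Qed.

Lemma modulusBl z w : modulus z - modulus w <= modulus (z - w).
Proof. by rewrite lerBlDr (le_trans _ (modulusD _ _))// subrK. Qed.

Lemma sqr_modulus z : modulus z ^+ 2 = complex.Re z ^+ 2 + complex.Im z ^+ 2.
Proof. by case: z => a b; rewrite /modulus /= sqr_sqrtr// addr_ge0 ?sqr_ge0. Qed.

Lemma Re_le_modulus z : `|complex.Re z| <= modulus z.
Proof.
rewrite -(ler_pXn2r (n := 2))// ?nnegrE ?modulus_ge0//.
by rewrite sqr_modulus real_normK ?num_real// lerDl sqr_ge0.
Qed.

Lemma Im_le_modulus z : `|complex.Im z| <= modulus z.
Proof.
rewrite -(ler_pXn2r (n := 2))// ?nnegrE ?modulus_ge0//.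
by rewrite sqr_modulus real_normK ?num_real// lerDr sqr_ge0.
Qed.

Lemma modulus_le_ReIm z : modulus z <= `|complex.Re z| + `|complex.Im z|.
Proof.
rewrite -(ler_pXn2r (n := 2))// ?nnegrE ?modulus_ge0 ?addr_ge0//.
rewrite sqr_modulus sqrrD !real_normK ?num_real// -addrA lerD2l lerDr.
by rewrite mulrn_wge0// mulr_ge0.
Qed.

Lemma ltC_tc (x y : R) : (tc x < tc y) = (x < y).
Proof. exact: ltcR. Qed.

(** Balls of [CC R] have radii in [CC R], but a positive complex number is real, since the order
    compares only numbers with equal imaginary parts. *)
Lemma nbhs_modulus z (A : set (CC R)) :
  nbhs z A <-> exists2 e : R, 0 < e & forall w, modulus (w - z) < e -> A w.
Proof.
split=> [/nbhs_ballP[e /= e0 zA]|[e e0 zA]].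
  have e0' : (0 : CC R) < e by [].
  have eE : e = tc (complex.Re e).
    by move: e0' {zA e0}; case: e => a b; rewrite ltcE /= => /andP[/eqP -> _].
  exists (complex.Re e); first by rewrite -(@ltC_tc 0) -eE.
  move=> w zw; apply: zA; rewrite -ball_normE /ball_ /=.
  by rewrite eE normCE ltC_tc modulusB.
apply/nbhs_ballP; exists (tc e); first by rewrite /= (@ltC_tc 0).
move=> w; rewrite -ball_normE /ball_ /= normCE ltC_tc modulusB => zw.
exact: zA.
Qed.

Lemma cvg_modulus (T : Type) (F : set_system T) (FF : Filter F)
    (f : T -> CC R) z :
  f @ F --> z <-> forall e : R, 0 < e -> \forall x \near F, modulus (f x - z) < e.
Proof.
split=> [fz e e0|fz A /nbhs_modulus[e e0 eA]].
  by apply: (fz [set w | modulus (w - z) < e]); apply/nbhs_modulus; exists e.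
by apply: filterS (fz e e0) => x; exact: eA.
Qed.

Lemma real_cvg_modulus (f : CC R -> R) z :
  (forall e : R, 0 < e -> exists2 k : R, 0 < k &
     forall w, modulus (w - z) < k -> `|f w - f z| < e) ->
  {for z, continuous f}.
Proof.
move=> fz A /nbhs_ballP[e /= e0 eA]; have [k k0 kf] := fz _ e0.
apply/(nbhs_modulus z (f @^-1` A)); exists k => // w wz.
by apply: eA; rewrite /ball /= distrC kf.
Qed.

Lemma continuous_modulus : continuous (@modulus R).
Proof.
move=> z; apply: real_cvg_modulus => e e0; exists e => // w wz.
rewrite ltr_norml /=; have := modulusBl w z; have := modulusBl z w.
rewrite (modulusB z w); lra.
Qed.

Lemma continuous_ReC : continuous (fun z : CC R => complex.Re z).
Proof.
move=> z; apply: real_cvg_modulus => e e0; exists e => // w wz.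
rewrite (le_lt_trans _ wz)//.
by rewrite (le_trans _ (Re_le_modulus _))//; case: w z {wz} => a b [c d].
Qed.

Lemma continuous_ImC : continuous (fun z : CC R => complex.Im z).
Proof.
move=> z; apply: real_cvg_modulus => e e0; exists e => // w wz.
rewrite (le_lt_trans _ wz)//.
by rewrite (le_trans _ (Im_le_modulus _))//; case: w z {wz} => a b [c d].
Qed.

(** The disc is a closed subset of the circumscribed square, a continuous image of a product of two
    segments. *)
Lemma closed_disc_compact c (r : R) :
  compact [set z : CC R | modulus (z - c) <= r].
Proof.
pose f (q : R * R) : CC R := (q.1 +i* q.2)%C.
have cf : continuous f.
  move=> q; apply/cvg_modulus => e e0.
  have e2 : 0 < e / 2 by rewrite divr_gt0.
  exists (ball q.1 (e / 2), ball q.2 (e / 2)).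
    by split; exact: nbhsx_ballx.
  move=> [a b] [/= H1 H2].
  change (modulus (f (a, b) - f q) < e).
  apply: le_lt_trans (modulus_le_ReIm _) _.
  rewrite /f; case: q H1 H2 => a0 b0 H1 H2 /=.
  rewrite (splitr e) ltrD//; rewrite distrC.
    exact: H1.
  exact: H2.
set K := [set z | _].
have cK : compact (f @` (`[complex.Re c - r, complex.Re c + r] `*`
                         `[complex.Im c - r, complex.Im c + r])).
  apply: continuous_compact; first exact/continuous_subspaceT.
  by apply: compact_setX; exact: segment_compact.
apply: (subclosed_compact _ cK).
  move=> z Kz; rewrite /K /= leNgt; apply/negP => rz.
  have [w [Kw zw]] : K `&` [set w | modulus (w - z) < modulus (z - c) - r] !=set0.
    by apply: Kz; apply/nbhs_modulus; exists (modulus (z - c) - r); rewrite ?subr_gt0.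
  have := modulus_triB z w c; move: zw Kw; rewrite /K /= (modulusB w z); lra.
case=> a b zr; exists (a, b) => //.
have := Re_le_modulus ((a +i* b)%C - c); have := Im_le_modulus ((a +i* b)%C - c).
move=> /le_trans/(_ zr) H1 /le_trans/(_ zr) H2.
move: H1 H2; case: (c) => u v /=; rewrite !ler_norml => /andP[? ?] /andP[? ?].
by split; rewrite /= in_itv /=; apply/andP; split; lra.
Qed.

End Modulus.

(** * Complex derivative *)

Section ComplexDerivative.
Context {R : realType}.
Implicit Types (f g : CC R -> CC R) (z w l : CC R).

(** The error is multiplied out, so that w = z needs no exclusion and no quotient appears. *)
Definition cdiff f z l : Prop := forall e : R, 0 < e ->
  exists2 k : R, 0 < k & forall w, modulus (w - z) < k ->
    modulus (f w - f z - l * (w - z)) <= e * modulus (w - z).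

Lemma cdiffP f z l : is_derive z 1 f l <-> cdiff f z l.
Proof.
split=> [fl e e0|fl].
  have := @ex_derive _ _ _ _ _ _ _ fl.
  have := @derive_val _ _ _ _ _ _ _ fl.
  rewrite /derivable /derive => <- /cvg_modulus/(_ e e0)/nbhs_modulus.
  set l' := lim _ => -[k k0 kf]; exists k => // w wz.
  have [->|wz0] := eqVneq w z.
    by rewrite !subrr mulr0 subrr modulus0 mulr0.
  have wz0' : w - z != 0 by rewrite subr_eq0.
  have := kf (w - z); rewrite subr0 => /(_ wz wz0').
  rewrite /= /GRing.scale /= mulr1 subrK => H.
  have {H} : modulus ((w - z)^-1 * (f w - f z) - l') < e by exact: H.
  rewrite -(ltr_pM2r (x := modulus (w - z))) ?modulus_gt0// -modulusM => /ltW.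
  by rewrite mulrBl mulrAC mulVf// mul1r.
suff H : h^-1 *: (f (h *: 1 + z) - f z) @[h --> 0^'] --> l.
  by split; [apply/cvg_ex; exists l|exact: cvg_lim H].
apply/cvg_modulus => e e0; have e2 : 0 < e / 2 by rewrite divr_gt0.
have [k k0 kf] := fl _ e2.
apply/nbhs_modulus; exists k => // h; rewrite subr0 => hk h0.
have := kf (h + z); rewrite addrK => /(_ hk).
have hm : 0 < modulus h by rewrite modulus_gt0.
rewrite /= /GRing.scale /= mulr1 => H.
rewrite -(ltr_pM2r hm) -modulusM mulrBl mulrAC mulVf// mul1r.
by rewrite (le_lt_trans H)// ltr_pM2r// ltr_pdivrMr// ltr_pMr// ltr1n.
Qed.

Lemma derivable_cdiff f z : derivable f z 1 -> cdiff f z (cderiv f z).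
Proof. by move=> /derivableP; rewrite -derive1E => /cdiffP. Qed.

Lemma cdiff_cderiv f z l : cdiff f z l -> cderiv f z = l.
Proof. by move=> /cdiffP fl; rewrite /cderiv derive1E derive_val. Qed.

Lemma cdiff_continuous f z l : cdiff f z l -> {for z, continuous f}.
Proof.
move=> /cdiffP fl; apply: differentiable_continuous.
by apply/derivable1_diffP; exact: ex_derive.
Qed.

Lemma cdiff_id z : cdiff id z 1.
Proof. by apply/cdiffP. Qed.

Lemma cdiff_cst c z : cdiff (fun=> c) z 0.
Proof. by apply/cdiffP. Qed.

Lemma cdiffD f g z l m : cdiff f z l -> cdiff g z m ->
  cdiff (fun w => f w + g w) z (l + m).
Proof. by move=> /cdiffP fl /cdiffP gm; apply/cdiffP; apply: is_deriveD. Qed.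

Lemma cdiffB f g z l m : cdiff f z l -> cdiff g z m ->
  cdiff (fun w => f w - g w) z (l - m).
Proof. by move=> /cdiffP fl /cdiffP gm; apply/cdiffP; apply: is_deriveB. Qed.

Lemma cdiffM f g z l m : cdiff f z l -> cdiff g z m ->
  cdiff (fun w => f w * g w) z (l * g z + f z * m).
Proof.
move=> /cdiffP fl /cdiffP gm; apply/cdiffP.
have := @is_deriveM _ _ f g z 1 l m fl gm.
by rewrite addrC /GRing.scale /= (mulrC (g z)).
Qed.

Lemma cdiffV f z l : f z != 0 -> cdiff f z l ->
  exists m, cdiff (fun w => (f w)^-1) z m.
Proof.
move=> fz0 /cdiffP fl; eexists; apply/cdiffP/derivableP.
by apply: derivableV => //; exact: ex_derive.
Qed.

Lemma cdiff_horner (p : {poly CC R}) z : cdiff (horner p) z p^`().[z].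
Proof.
elim/poly_ind: p => [|p c IH].
  have -> : horner (0 : {poly CC R}) = fun=> 0 by apply/funext => w; rewrite horner0.
  by rewrite deriv0 horner0; exact: cdiff_cst.
have -> : horner (p * 'X + c%:P) = fun w => p.[w] * w + c.
  by apply/funext => w; rewrite !hornerE.
rewrite derivD derivM derivX derivC mulr1 addr0 !hornerE.
have := cdiffD _ _ _ _ _ (cdiffM _ _ _ _ _ IH (cdiff_id z)) (cdiff_cst c z).
by rewrite mulr1 addr0.
Qed.

Lemma continuous_hornerC (p : {poly CC R}) : continuous (horner p).
Proof. by move=> z; apply: cdiff_continuous (cdiff_horner p z). Qed.

End ComplexDerivative.

(** * Goursat's theorem *)

Section RealPrimitive.
Context {R : realType}.
Implicit Types (f g F G : R -> R) (a b : R).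

(** The derivative is two-sided at [a] and [b] as well, so [G] must behave well slightly beyond the
    segment. *)
Definition primitive_on a b G g : Prop :=
  forall x, a <= x <= b -> is_derive x 1 G (g x).

Lemma primitive_mvt G g a b : a <= b -> primitive_on a b G g ->
  exists2 c, a <= c <= b & G b - G a = g c * (b - a).
Proof.
rewrite le_eqVlt => /predU1P[<- _|ab Gg].
  by exists a; rewrite ?lexx// !subrr mulr0.
have [|x|c] := @MVT R G g a b ab.
- by move=> x /[!in_itv]/= /andP[? ?]; apply: Gg; rewrite !ltW.
- apply: derivable_within_continuous => y /[!in_itv]/= yab.
  by apply: ex_derive; exact: Gg.
- by move=> /[!in_itv]/= /andP[? ?]; exists c => //; rewrite !ltW.
Qed.

(** Precomposing with the retraction [k] of the line onto [a, b] makes [f] continuous everywhere.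
    Integrating from a - 1 up to b + 1 makes the endpoints interior, which gives two-sided
    derivatives there. *)
Lemma exists_primitive f a b : a <= b ->
  (forall x, a <= x <= b -> {for x, continuous f}) ->
  exists G, primitive_on a b G f.
Proof.
move=> ab cf.
pose k x : R := Num.max a (Num.min x b).
have kab x : a <= k x <= b by rewrite /k ge_max ab le_max lexx ge_min lexx orbT.
have kid x : a <= x <= b -> k x = x.
  by move=> /andP[ax xb]; rewrite /k min_l// max_r.
have ck : continuous k.
  move=> x; apply: (@continuous_max _ _ (cst a) (fun x => Num.min x b)).
    exact: cvg_cst.
  by apply: (@continuous_min _ _ id (cst b)); [exact: cvg_id|exact: cvg_cst].
pose g := f \o k.
have cg : continuous g.
  by move=> x; apply: continuous_comp; [exact: ck|exact: cf].
have ig : (@lebesgue_measure R).-integrable `[a - 1, b + 1] (EFin \o g).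
  apply: continuous_compact_integrable; first exact: segment_compact.
  exact: continuous_subspaceT.
exists (fun x => (\int[lebesgue_measure]_(t in [set` `[a - 1, x]]) g t)%R).
move=> x xab; have /andP[ax xb] := xab.
have := @continuous_FTC1_closed R g (a - 1) x (b + 1) _ ig _ (cg x).
case; [lra|lra|move=> dG dGE].
rewrite (_ : f x = g x); last by rewrite /g /= kid.
by rewrite -dGE; split; [exact: dG|rewrite derive1E].
Qed.

(** The integral is an increment of some primitive; additivity and bounds then reduce to the mean
    value theorem, which also shows independence of the choice ([ointE]). *)
Definition oint f a b : R :=
  get [set v | exists2 G, primitive_on a b G f & v = G b - G a].

Lemma primitiveB a b G g F f : primitive_on a b G g -> primitive_on a b F f ->
  primitive_on a b (fun x => G x - F x) (fun x => g x - f x).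
Proof. by move=> Gg Ff x xab; apply: is_deriveB; [exact: Gg|exact: Ff]. Qed.

Lemma ointE f a b G : a <= b -> primitive_on a b G f -> oint f a b = G b - G a.
Proof.
move=> ab Gf; rewrite /oint; case: xgetP => [_ -> [F Ff ->]|/(_ (G b - G a))].
  have [c _] := primitive_mvt _ _ _ _ ab (primitiveB _ _ _ _ _ _ Gf Ff).
  rewrite subrr mul0r; lra.
by case; exists G.
Qed.

Lemma ointD f a m b : a <= m -> m <= b ->
  (forall x, a <= x <= b -> {for x, continuous f}) ->
  oint f a b = oint f a m + oint f m b.
Proof.
move=> am mb cf; have [G Gf] := exists_primitive _ _ _ (le_trans am mb) cf.
rewrite (ointE _ _ _ G (le_trans am mb))// (ointE _ _ _ G am); last first.
  by move=> x /andP[? ?]; apply: Gf; apply/andP; split => //; lra.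
rewrite (ointE _ _ _ G mb); last first.
  by move=> x /andP[? ?]; apply: Gf; apply/andP; split => //; lra.
lra.
Qed.

Lemma oint_approx f k K a b m : a <= b ->
  (forall x, a <= x <= b -> {for x, continuous f}) -> primitive_on a b K k ->
  (forall x, a <= x <= b -> `|f x - k x| <= m) ->
  `|oint f a b - (K b - K a)| <= m * (b - a).
Proof.
move=> ab cf Kk fk; have [G Gf] := exists_primitive _ _ _ ab cf.
rewrite (ointE _ _ _ G ab)//.
have [c cab] := primitive_mvt _ _ _ _ ab (primitiveB _ _ _ _ _ _ Gf Kk).
move=> H; rewrite (_ : _ - _ = (f c - k c) * (b - a)); last by rewrite -H; ring.
have ba : 0 <= b - a by rewrite subr_ge0.
by rewrite normrM (ger0_norm ba) ler_wpM2r// fk.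
Qed.

Lemma oint_ge f a b m : a <= b ->
  (forall x, a <= x <= b -> {for x, continuous f}) ->
  (forall x, a <= x <= b -> m <= f x) -> m * (b - a) <= oint f a b.
Proof.
move=> ab cf fm; have [G Gf] := exists_primitive _ _ _ ab cf.
rewrite (ointE _ _ _ G ab)//; have [c cab ->] := primitive_mvt _ _ _ _ ab Gf.
by rewrite ler_wpM2r ?subr_ge0// fm.
Qed.

Lemma oint_le f a b m : a <= b ->
  (forall x, a <= x <= b -> {for x, continuous f}) ->
  (forall x, a <= x <= b -> f x <= m) -> oint f a b <= m * (b - a).
Proof.
move=> ab cf fm; have [G Gf] := exists_primitive _ _ _ ab cf.
rewrite (ointE _ _ _ G ab)//; have [c cab ->] := primitive_mvt _ _ _ _ ab Gf.
by rewrite ler_wpM2r ?subr_ge0// fm.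
Qed.

Lemma nested_intervals (x w : nat -> R) : (forall n, 0 <= w n) ->
  (forall n, x n <= x n.+1) -> (forall n, x n.+1 + w n.+1 <= x n + w n) ->
  exists c, forall n, x n <= c <= x n + w n.
Proof.
move=> w0 xS xwS.
have xm n m : x n <= x (n + m)%N.
  by elim: m => [|m IH]; rewrite ?addn0// addnS (le_trans IH).
have xwm n m : x (n + m)%N + w (n + m)%N <= x n + w n.
  by elim: m => [|m IH]; rewrite ?addn0// addnS (le_trans (xwS _)).
have ub n m : x m <= x n + w n.
  rewrite (le_trans (xm m n))// (le_trans _ (xwm n m))// addnC.
  by rewrite lerDl.
exists (sup (range x)) => n; apply/andP; split.
  apply: ub_le_sup; last by exists n.
  by exists (x 0%N + w 0%N) => _ [m _ <-].
apply: ge_sup; first by exists (x 0%N), 0%N.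
by move=> _ [m _ <-].
Qed.

End RealPrimitive.

(** * Integrals along rectangles and the bisection argument *)

Section Goursat.
Context {R : realType}.
Implicit Types (F : CC R -> CC R) (x y : R).

Definition pt x y : CC R := (x +i* y)%C.

(** Since dz is dx on horizontal edges and i dy on vertical ones, Im (F dz) is Im F dx or Re F dy.
    The imaginary part is the one kept because it detects the residue of 1 / z. *)
Definition hedge F y x1 x2 := oint (fun x => complex.Im (F (pt x y))) x1 x2.
Definition vedge F x y1 y2 := oint (fun y => complex.Re (F (pt x y))) y1 y2.

(* The integral of Im (F dz) along the boundary of the rectangle. *)
Definition rect_int F x1 x2 y1 y2 : R :=
  hedge F y1 x1 x2 + vedge F x2 y1 y2 - hedge F y2 x1 x2 - vedge F x1 y1 y2.

Definition cdiff_rect F x1 x2 y1 y2 : Prop := forall x y,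
  x1 <= x <= x2 -> y1 <= y <= y2 -> exists l, cdiff F (pt x y) l.

Lemma cdiff_rect_sub F x1 x2 y1 y2 u1 u2 v1 v2 :
  x1 <= u1 -> u2 <= x2 -> y1 <= v1 -> v2 <= y2 ->
  cdiff_rect F x1 x2 y1 y2 -> cdiff_rect F u1 u2 v1 v2.
Proof.
by move=> ? ? ? ? DF x y /andP[? ?] /andP[? ?]; apply: DF; apply/andP; split; lra.
Qed.

Lemma modulus_pt x y : modulus (pt x y) <= `|x| + `|y|.
Proof. exact: modulus_le_ReIm. Qed.

Lemma ptB x y u v : pt x y - pt u v = pt (x - u) (y - v).
Proof. by []. Qed.

Lemma continuous_ptl y : continuous (fun x => pt x y).
Proof.
move=> x; apply/cvg_modulus => e e0.
have : nbhs x (ball x e) by exact: nbhsx_ballx.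
apply: filterS => u; rewrite /ball /= => xu.
change (modulus (pt u y - pt x y) < e).
by rewrite ptB (le_lt_trans (modulus_pt _ _))// subrr normr0 addr0 distrC.
Qed.

Lemma continuous_ptr x : continuous (fun y => pt x y).
Proof.
move=> y; apply/cvg_modulus => e e0.
have : nbhs y (ball y e) by exact: nbhsx_ballx.
apply: filterS => u; rewrite /ball /= => xu.
change (modulus (pt x u - pt x y) < e).
by rewrite ptB (le_lt_trans (modulus_pt _ _))// subrr normr0 add0r distrC.
Qed.

Lemma hedge_continuous F x y : (exists l, cdiff F (pt x y) l) ->
  {for x, continuous (fun x => complex.Im (F (pt x y)))}.
Proof.
move=> [l /cdiff_continuous cF].
apply: (@continuous_comp _ _ _ (fun x => F (pt x y)) (fun z => complex.Im z)).
  by apply: (@continuous_comp _ _ _ (fun x => pt x y) F); [exact: continuous_ptl|exact: cF].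
exact: continuous_ImC.
Qed.

Lemma vedge_continuous F x y : (exists l, cdiff F (pt x y) l) ->
  {for y, continuous (fun y => complex.Re (F (pt x y)))}.
Proof.
move=> [l /cdiff_continuous cF].
apply: (@continuous_comp _ _ _ (fun y => F (pt x y)) (fun z => complex.Re z)).
  by apply: (@continuous_comp _ _ _ (fun y => pt x y) F); [exact: continuous_ptr|exact: cF].
exact: continuous_ReC.
Qed.

Lemma hedgeD F y x1 xm x2 : x1 <= xm -> xm <= x2 ->
  (forall x, x1 <= x <= x2 -> exists l, cdiff F (pt x y) l) ->
  hedge F y x1 x2 = hedge F y x1 xm + hedge F y xm x2.
Proof.
by move=> ? ? DF; apply: ointD => // x xx; exact/hedge_continuous/DF.
Qed.

Lemma vedgeD F x y1 ym y2 : y1 <= ym -> ym <= y2 ->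
  (forall y, y1 <= y <= y2 -> exists l, cdiff F (pt x y) l) ->
  vedge F x y1 y2 = vedge F x y1 ym + vedge F x ym y2.
Proof.
by move=> ? ? DF; apply: ointD => // y yy; exact/vedge_continuous/DF.
Qed.

Lemma rect_int_split F x1 xm x2 y1 ym y2 :
  x1 <= xm -> xm <= x2 -> y1 <= ym -> ym <= y2 -> cdiff_rect F x1 x2 y1 y2 ->
  rect_int F x1 x2 y1 y2 =
    rect_int F x1 xm y1 ym + rect_int F xm x2 y1 ym +
    (rect_int F x1 xm ym y2 + rect_int F xm x2 ym y2).
Proof.
move=> x1m xm2 y1m ym2 DF; rewrite /rect_int.
rewrite (hedgeD _ y1 _ _ _ x1m xm2); last first.
  by move=> x xx; apply: DF => //; apply/andP; split; lra.
rewrite (hedgeD _ y2 _ _ _ x1m xm2); last first.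
  by move=> x xx; apply: DF => //; apply/andP; split; lra.
rewrite (vedgeD _ x1 _ _ _ y1m ym2); last first.
  by move=> x xx; apply: DF => //; apply/andP; split; lra.
rewrite (vedgeD _ x2 _ _ _ y1m ym2); last first.
  by move=> x xx; apply: DF => //; apply/andP; split; lra.
ring.
Qed.

Lemma is_derive_quadratic (a b c x : R) :
  is_derive x 1 (fun t => a * (t - c) + b * (t - c) ^+ 2) (a + b * (2 * (x - c))).
Proof.
apply: is_derive_eq.
by rewrite /GRing.scale /=; ring.
Qed.

(** The affine part of [F] has explicit primitives [KH] and [KV] along the edges, whose increments
    cancel around the rectangle. What remains is an error of at most e D on a perimeter of length 2
    D. *)
Lemma rect_int_small F x1 x2 y1 y2 x0 y0 l e :
  x1 <= x0 <= x2 -> y1 <= y0 <= y2 -> 0 <= e -> cdiff_rect F x1 x2 y1 y2 ->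
  (forall x y, x1 <= x <= x2 -> y1 <= y <= y2 ->
    modulus (F (pt x y) - F (pt x0 y0) - l * (pt x y - pt x0 y0)) <=
    e * modulus (pt x y - pt x0 y0)) ->
  `|rect_int F x1 x2 y1 y2| <= 2 * e * ((x2 - x1) + (y2 - y1)) ^+ 2.
Proof.
move=> x0P y0P e0 DF Fl; have /andP[x10 x02] := x0P; have /andP[y10 y02] := y0P.
have x12 : x1 <= x2 by lra. have y12 : y1 <= y2 by lra.
set D := (x2 - x1) + (y2 - y1).
have Fl' x y : x1 <= x <= x2 -> y1 <= y <= y2 ->
    modulus (F (pt x y) - F (pt x0 y0) - l * (pt x y - pt x0 y0)) <= e * D.
  move=> xP yP; apply: le_trans (Fl _ _ xP yP) _; rewrite ler_wpM2l//.
  rewrite ptB (le_trans (modulus_pt _ _))// /D.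
  by rewrite lerD// ler_norml; move: xP yP => /andP[? ?] /andP[? ?];
    apply/andP; split; lra.
case: (F (pt x0 y0)) Fl' {Fl} => u v; case: l => p q Fl.
have FI x y : x1 <= x <= x2 -> y1 <= y <= y2 ->
    `|complex.Im (F (pt x y)) - (v + p * (y - y0) + q * (x - x0))| <= e * D.
  move=> xP yP; apply: le_trans (Fl _ _ xP yP).
  apply: le_trans (Im_le_modulus _); rewrite ptB.
  case: (F (pt x y)) => a b /=; rewrite le_eqVlt; apply/orP; left; apply/eqP.
  by congr `|_|; ring.
have FR x y : x1 <= x <= x2 -> y1 <= y <= y2 ->
    `|complex.Re (F (pt x y)) - (u + p * (x - x0) - q * (y - y0))| <= e * D.
  move=> xP yP; apply: le_trans (Fl _ _ xP yP).
  apply: le_trans (Re_le_modulus _); rewrite ptB.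
  case: (F (pt x y)) => a b /=; rewrite le_eqVlt; apply/orP; left; apply/eqP.
  by congr `|_|; ring.
pose KH y x := (v + p * (y - y0)) * (x - x0) + (q / 2) * (x - x0) ^+ 2.
pose KV x y := (u + p * (x - x0)) * (y - y0) + (- q / 2) * (y - y0) ^+ 2.
have H y : y1 <= y <= y2 ->
    `|hedge F y x1 x2 - (KH y x2 - KH y x1)| <= e * D * (x2 - x1).
  move=> yP; apply: (oint_approx _ (fun x => v + p * (y - y0) + q * (x - x0))) => //.
  - by move=> x xP; exact/hedge_continuous/DF.
  - move=> x xP; have := is_derive_quadratic (v + p * (y - y0)) (q / 2) x0 x.
    by rewrite mulrA divfK.
  - by move=> x xP; exact: FI.
have V x : x1 <= x <= x2 ->
    `|vedge F x y1 y2 - (KV x y2 - KV x y1)| <= e * D * (y2 - y1).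
  move=> xP; apply: (oint_approx _ (fun y => u + p * (x - x0) - q * (y - y0))) => //.
  - by move=> y yP; exact/vedge_continuous/DF.
  - move=> y yP; have := is_derive_quadratic (u + p * (x - x0)) (- q / 2) y0 y.
    by rewrite mulrA divfK// (mulNr q (y - y0)).
  - by move=> y yP; exact: FR.
have H1 := H y1; have H2 := H y2; have V1 := V x1; have V2 := V x2.
rewrite /rect_int.
rewrite lexx y12 in H1; rewrite lexx y12 in H2.
rewrite lexx x12 in V1; rewrite lexx x12 in V2.
move: (H1 isT) (H2 isT) (V1 isT) (V2 isT).
have KE : (KH y1 x2 - KH y1 x1) + (KV x2 y2 - KV x2 y1)
   - (KH y2 x2 - KH y2 x1) - (KV x1 y2 - KV x1 y1) = 0.
  by rewrite /KH /KV; field.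
rewrite (_ : 2 * e * D ^+ 2 = e * D * (x2 - x1) + e * D * (y2 - y1)
  + e * D * (x2 - x1) + e * D * (y2 - y1)); last by rewrite /D; ring.
move: KE; clear.
move: (KH y1 x2 - KH y1 x1) (KV x2 y2 - KV x2 y1) (KH y2 x2 - KH y2 x1).
move: (KV x1 y2 - KV x1 y1) (e * D * (x2 - x1)) (e * D * (y2 - y1)).
move=> a b c a' b' c' ?; rewrite !ler_norml.
move=> /andP[? ?] /andP[? ?] /andP[? ?] /andP[? ?]; apply/andP; split; lra.
Qed.

Lemma goursat F x1 x2 y1 y2 : x1 <= x2 -> y1 <= y2 ->
  cdiff_rect F x1 x2 y1 y2 -> rect_int F x1 x2 y1 y2 = 0.
Proof.
move=> x12 y12 DF; pose W := x2 - x1; pose H := y2 - y1.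
have W0 : 0 <= W by rewrite subr_ge0.
have H0 : 0 <= H by rewrite subr_ge0.
pose w n : R := W / 2 ^+ n; pose h n : R := H / 2 ^+ n.
have w0 n : 0 <= w n by rewrite divr_ge0// exprn_ge0.
have h0 n : 0 <= h n by rewrite divr_ge0// exprn_ge0.
have wS n : w n = 2 * w n.+1.
  by rewrite /w exprS; field; rewrite expf_neq0.
have hS n : h n = 2 * h n.+1.
  by rewrite /h exprS; field; rewrite expf_neq0.
pose J n (q : R * R) := rect_int F q.1 (q.1 + w n) q.2 (q.2 + h n).
pose inside n (q : R * R) := [/\ x1 <= q.1, q.1 + w n <= x2, y1 <= q.2 & q.2 + h n <= y2].
(* The quarter carrying at least a fourth of the integral. [inside] is a premise, so that the
   statement holds for every pair and [choice] yields a total successor function. *)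
have step (nq : nat * (R * R)) : exists q', inside nq.1 nq.2 -> 
    [/\ inside nq.1.+1 q', `|J nq.1 nq.2| <= 4 * `|J nq.1.+1 q'|,
       nq.2.1 <= q'.1, q'.1 + w nq.1.+1 <= nq.2.1 + w nq.1 & 
       nq.2.2 <= q'.2 /\ q'.2 + h nq.1.+1 <= nq.2.2 + h nq.1].
  case: nq => n [x y] /=.
  have [[a1 a2 b1 b2]|] := pselect (inside n (x, y)); last by exists (x, y).
  rewrite /= wS in a2; rewrite /= hS in b2; move: a1 b1 => /= a1 b1.
  have w1 := w0 n.+1; have h1 := h0 n.+1.
  have JE : J n (x, y) = rect_int F x (x + w n.+1) y (y + h n.+1) +
      rect_int F (x + w n.+1) (x + w n) y (y + h n.+1) +
      (rect_int F x (x + w n.+1) (y + h n.+1) (y + h n) +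
       rect_int F (x + w n.+1) (x + w n) (y + h n.+1) (y + h n)).
    have wn := wS n; have hn := hS n.
    rewrite /J /=; apply: rect_int_split.
    - by lra.
    - by lra.
    - by lra.
    - by lra.
    - by apply: cdiff_rect_sub DF; lra.
  move: JE; rewrite [in RHS](wS n) [in RHS](hS n).
  set A1 := rect_int _ x (x + w n.+1) y _; set A2 := rect_int _ _ _ y _.
  set A3 := rect_int _ x _ (y + h n.+1) _; set A4 := rect_int _ _ _ _ _.
  move=> JE.
  have A2E : A2 = rect_int F (x + w n.+1) (x + w n.+1 + w n.+1) y (y + h n.+1).
    by rewrite /A2; congr (rect_int F _ _ _ _); ring.
  have A3E : A3 = rect_int F x (x + w n.+1) (y + h n.+1) (y + h n.+1 + h n.+1).
    by rewrite /A3; congr (rect_int F _ _ _ _); ring.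
  have A4E : A4 = rect_int F (x + w n.+1) (x + w n.+1 + w n.+1) (y + h n.+1) (y + h n.+1 + h n.+1).
    by rewrite /A4; congr (rect_int F _ _ _ _); ring.
  set A := J n (x, y) in JE *.
  have tri : `|A| <= `|A1| + `|A2| + (`|A3| + `|A4|).
    rewrite JE (le_trans (ler_normD _ _))// lerD// (le_trans (ler_normD _ _))//.
  have wn := wS n; have hn := hS n.
  have fin x' y' : `|A| <= 4 * `|J n.+1 (x', y')| ->
      x <= x' -> x' + w n.+1 <= x + w n -> y <= y' -> y' + h n.+1 <= y + h n ->
      exists q' : R * R, inside n (x, y) ->
      [/\ inside n.+1 q', `|A| <= 4 * `|J n.+1 q'|,
       x <= q'.1, q'.1 + w n.+1 <= x + w n &
       y <= q'.2 /\ q'.2 + h n.+1 <= y + h n].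
    by move=> ? ? ? ? ?; exists (x', y') => _; split=> //; split=> /=; lra.
  have [c1|c1] := lerP `|A| (4 * `|A1|); first by apply: (fin x y) => //; lra.
  have [c2|c2] := lerP `|A| (4 * `|A2|).
    by apply: (fin (x + w n.+1) y); [rewrite /J /= -A2E|lra..].
  have [c3|c3] := lerP `|A| (4 * `|A3|).
    by apply: (fin x (y + h n.+1)); [rewrite /J /= -A3E|lra..].
  by apply: (fin (x + w n.+1) (y + h n.+1)); [rewrite /J /= -A4E; lra|lra..].
have {step}[nxt nxtP] := choice step.
pose q := fix q n := if n is n'.+1 then nxt (n', q n') else (x1, y1).
have qin n : inside n (q n).
  elim: n => [|n IH]; last by have [] := nxtP (n, q n) IH.
  by split => //=; rewrite /w /h expr0 divr1 /W /H; lra.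
have qS n := nxtP (n, q n) (qin n).
have Jq n : `|J 0%N (q 0%N)| <= 4 ^+ n * `|J n (q n)|.
  elim: n => [|n IH]; first by rewrite expr0 mul1r.
  apply: le_trans IH _; rewrite exprSr -mulrA ler_wpM2l ?exprn_ge0//.
  by have [] := qS n.
have [||c cP] := nested_intervals (fun n => (q n).1) w w0.
- by move=> n; have [] := qS n.
- by move=> n; have [] := qS n.
have [||k kP] := nested_intervals (fun n => (q n).2) h h0.
- by move=> n; have [_ _ _ _ []] := qS n.
- by move=> n; have [_ _ _ _ []] := qS n.
have cx : x1 <= c <= x2.
  by have := cP 0%N; rewrite /= /w expr0 divr1 /W => /andP[? ?]; apply/andP; split; lra.
have ky : y1 <= k <= y2.
  by have := kP 0%N; rewrite /= /h expr0 divr1 /H => /andP[? ?]; apply/andP; split; lra.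
have [l Fl] := DF _ _ cx ky.
have JE : J 0%N (q 0%N) = rect_int F x1 x2 y1 y2.
  by rewrite /J /= /w /h expr0 !divr1 /W /H !subrKC.
apply/eqP; rewrite -normr_eq0 -JE eq_le normr_ge0 andbT.
apply/ler_addgt0Pr => e e0; rewrite add0r.
pose D := W + H; have D0 : 0 <= D by rewrite addr_ge0.
(* The final bound is 2 e' D^2 <= e; the added 1 keeps the denominator positive for a degenerate
   rectangle. *)
pose e' := e / (2 * (D ^+ 2 + 1)).
have D1 : 0 < D ^+ 2 + 1 by rewrite ltr_wpDl// sqr_ge0.
have e'0 : 0 < e' by rewrite divr_gt0// mulr_gt0.
have [r r0 rF] := Fl _ e'0.
have [n nP] : exists n, D / 2 ^+ n < r.
  pose n := (Num.truncn (D / r)).+1; exists n.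
  have n0 : (0 : R) < 2 ^+ n by rewrite exprn_gt0.
  rewrite ltr_pdivrMr// mulrC -ltr_pdivrMr//.
  have Dn : D / r < n%:R by rewrite truncnS_gt.
  apply: lt_le_trans Dn _; rewrite -natrX ler_nat.
  exact: ltnW (ltn_expl _ _).
apply: le_trans (Jq n) _.
have DwH : w n + h n = D / 2 ^+ n by rewrite /w /h -mulrDl.
have sm : `|J n (q n)| <= 2 * e' * (w n + h n) ^+ 2.
  have [i1 i2 i3 i4] := qin n.
  have -> : w n + h n = ((q n).1 + w n - (q n).1) + ((q n).2 + h n - (q n).2) by ring.
  apply: (rect_int_small _ _ _ _ _ c k l) => //; first exact: ltW.
    exact: cdiff_rect_sub DF.
  move=> x y /andP[xa xb] /andP[ya yb]; apply: rF.
  rewrite ptB (le_lt_trans (modulus_pt _ _))// (le_lt_trans _ nP)// -DwH.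
  have /andP[? ?] := cP n; have /andP[? ?] := kP n.
  by rewrite lerD// ler_norml; apply/andP; split; lra.
apply: le_trans (_ : 4 ^+ n * (2 * e' * (w n + h n) ^+ 2) <= _).
  by rewrite ler_wpM2l// exprn_ge0.
have -> : 4 ^+ n = (2 ^+ n) ^+ 2 :> R.
  by rewrite -exprM mulnC exprM; congr (_ ^+ n); ring.
have n2 : 2 ^+ n != 0 :> R by rewrite expf_neq0.
rewrite DwH (_ : _ * _ = e * (D ^+ 2 / (D ^+ 2 + 1))); last first.
  by rewrite /e'; field; rewrite n2 gt_eqF.
by rewrite ger_pMr// ler_pdivrMr// mul1r lerDl.
Qed.

End Goursat.

(** * Cauchy estimate *)

Section CauchyEstimate.
Context {R : realType}.
Implicit Types (f F : CC R -> CC R) (x y : R) (z c l : CC R).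

(* The two squares are centred at [pt u v]; the ring between them is cut into
   four rectangles avoiding the centre. *)
Lemma rect_int_ring F u v s S : 0 < s -> s <= S ->
  (forall x y, u - S <= x <= u + S -> v - S <= y <= v + S ->
     pt x y != pt u v -> exists l, cdiff F (pt x y) l) ->
  rect_int F (u - S) (u + S) (v - S) (v + S) =
  rect_int F (u - s) (u + s) (v - s) (v + s).
Proof.
move=> s0 sS DF.
have ne x y : x != u \/ y != v -> pt x y != pt u v.
  by move=> xy; apply/eqP => -[xu yv]; case: xy; rewrite ?xu ?yv eqxx.
have bot : cdiff_rect F (u - S) (u + S) (v - S) (v - s).
  move=> x y xP /andP[? ?]; apply: DF => //; first by apply/andP; split; lra.
  by apply: ne; right; lra.
have top : cdiff_rect F (u - S) (u + S) (v + s) (v + S).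
  move=> x y xP /andP[? ?]; apply: DF => //; first by apply/andP; split; lra.
  by apply: ne; right; lra.
(* [lft] and [rgt] overlap the corners and only justify splitting the outer vertical edges; the
   trimmed [lft'] and [rgt'] complete the ring together with [bot] and [top]. *)
have lft : cdiff_rect F (u - S) (u - s) (v - S) (v + S).
  move=> x y /andP[? ?] yP; apply: DF => //; first by apply/andP; split; lra.
  by apply: ne; left; lra.
have rgt : cdiff_rect F (u + s) (u + S) (v - S) (v + S).
  move=> x y /andP[? ?] yP; apply: DF => //; first by apply/andP; split; lra.
  by apply: ne; left; lra.
have lft' : cdiff_rect F (u - S) (u - s) (v - s) (v + s).
  by apply: cdiff_rect_sub lft; lra.
have rgt' : cdiff_rect F (u + s) (u + S) (v - s) (v + s).
  by apply: cdiff_rect_sub rgt; lra.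
have xm : u - S <= u - s by lra. have xm' : u - s <= u + s by lra.
have xm'' : u + s <= u + S by lra. have xm3 : u - s <= u + S by lra.
have ym : v - S <= v - s by lra. have ym' : v - s <= v + s by lra.
have ym'' : v + s <= v + S by lra. have ym3 : v - s <= v + S by lra.
have xS : u - S <= u + S by lra.
have := goursat _ _ _ _ _ xS ym bot; have := goursat _ _ _ _ _ xS ym'' top.
have := goursat _ _ _ _ _ xm ym' lft'; have := goursat _ _ _ _ _ xm'' ym' rgt'.
rewrite /rect_int.
rewrite (hedgeD _ (v - s) _ _ _ xm xm3); last first.
  by move=> x xP; apply: bot => //; apply/andP; split; lra.
rewrite (hedgeD _ (v - s) _ _ _ xm' xm''); last first.
  by move=> x /andP[? ?]; apply: bot => //; apply/andP; split; lra.
rewrite (hedgeD _ (v + s) _ _ _ xm xm3); last first.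
  by move=> x xP; apply: top => //; apply/andP; split; lra.
rewrite (hedgeD _ (v + s) _ _ _ xm' xm''); last first.
  by move=> x /andP[? ?]; apply: top => //; apply/andP; split; lra.
rewrite (vedgeD _ (u - S) _ _ _ ym ym3); last first.
  by move=> x xP; apply: lft => //; apply/andP; split; lra.
rewrite (vedgeD _ (u - S) _ _ _ ym' ym''); last first.
  by move=> x /andP[? ?]; apply: lft => //; apply/andP; split; lra.
rewrite (vedgeD _ (u + S) _ _ _ ym ym3); last first.
  by move=> x xP; apply: rgt => //; apply/andP; split; lra.
rewrite (vedgeD _ (u + S) _ _ _ ym' ym''); last first.
  by move=> x /andP[? ?]; apply: rgt => //; apply/andP; split; lra.
lra.
Qed.

(** The boundary has length 8 S, and its points lie at distance at least S and, by the l1 norm, at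
    most 2 S from the centre. *)
Lemma rect_int_square_le F u v S m : 0 < S ->
  (forall x y, u - S <= x <= u + S -> v - S <= y <= v + S ->
     pt x y != pt u v -> exists l, cdiff F (pt x y) l) ->
  (forall z, S <= modulus (z - pt u v) <= 2 * S -> modulus (F z) <= m) ->
  rect_int F (u - S) (u + S) (v - S) (v + S) <= 8 * S * m.
Proof.
move=> S0 DF Fm.
have xS : u - S <= u + S by lra. have yS : v - S <= v + S by lra.
have ne x y : x != u \/ y != v -> pt x y != pt u v.
  by move=> xy; apply/eqP => -[xu yv]; case: xy; rewrite ?xu ?yv eqxx.
have Fm' x y : `|x - u| <= S -> `|y - v| <= S -> S <= `|x - u| \/ S <= `|y - v| ->
    modulus (F (pt x y)) <= m.
  move=> xu yv xy; apply: Fm; rewrite ptB; apply/andP; split.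
    case: xy => /le_trans; apply; first exact: Re_le_modulus (pt _ _).
    exact: Im_le_modulus (pt _ _).
  by rewrite (le_trans (modulus_pt _ _))//; lra.
have Re_m x y : `|x - u| <= S -> `|y - v| <= S -> S <= `|x - u| \/ S <= `|y - v| ->
    - m <= complex.Re (F (pt x y)) <= m.
  by move=> *; rewrite -ler_norml (le_trans (Re_le_modulus _))// Fm'.
have Im_m x y : `|x - u| <= S -> `|y - v| <= S -> S <= `|x - u| \/ S <= `|y - v| ->
    - m <= complex.Im (F (pt x y)) <= m.
  by move=> *; rewrite -ler_norml (le_trans (Im_le_modulus _))// Fm'.
have nS : `|u - S - u| = S by rewrite addrAC subrr sub0r normrN gtr0_norm.
have nS' : `|u + S - u| = S by rewrite addrAC subrr add0r gtr0_norm.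
have mS : `|v - S - v| = S by rewrite addrAC subrr sub0r normrN gtr0_norm.
have mS' : `|v + S - v| = S by rewrite addrAC subrr add0r gtr0_norm.
have E1 : hedge F (v - S) (u - S) (u + S) <= m * (u + S - (u - S)).
  apply: oint_le => // x xP.
    apply: hedge_continuous; apply: DF => //; first by apply/andP; split; lra.
    by apply: ne; right; lra.
  have xu : `|x - u| <= S.
    by rewrite ler_norml; move/andP: xP => [? ?]; apply/andP; split; lra.
  have := Im_m x (v - S) xu; rewrite mS.
  by move=> /(_ (lexx _) (or_intror (lexx _)))/andP[].
have E2 : - m * (u + S - (u - S)) <= hedge F (v + S) (u - S) (u + S).
  apply: oint_ge => // x xP.
    apply: hedge_continuous; apply: DF => //; first by apply/andP; split; lra.
    by apply: ne; right; lra.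
  have xu : `|x - u| <= S.
    by rewrite ler_norml; move/andP: xP => [? ?]; apply/andP; split; lra.
  have := Im_m x (v + S) xu; rewrite mS'.
  by move=> /(_ (lexx _) (or_intror (lexx _)))/andP[].
have E3 : vedge F (u + S) (v - S) (v + S) <= m * (v + S - (v - S)).
  apply: oint_le => // y yP.
    apply: vedge_continuous; apply: DF => //; first by apply/andP; split; lra.
    by apply: ne; left; lra.
  have yv : `|y - v| <= S.
    by rewrite ler_norml; move/andP: yP => [? ?]; apply/andP; split; lra.
  have := Re_m (u + S) y; rewrite nS'.
  by move=> /(_ (lexx _) yv (or_introl (lexx _)))/andP[].
have E4 : - m * (v + S - (v - S)) <= vedge F (u - S) (v - S) (v + S).
  apply: oint_ge => // y yP.
    apply: vedge_continuous; apply: DF => //; first by apply/andP; split; lra.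
    by apply: ne; left; lra.
  have yv : `|y - v| <= S.
    by rewrite ler_norml; move/andP: yP => [? ?]; apply/andP; split; lra.
  have := Re_m (u - S) y; rewrite nS.
  by move=> /(_ (lexx _) yv (or_introl (lexx _)))/andP[].
rewrite /rect_int; lra.
Qed.

Lemma inv_pt (s t : R) : (pt s t)^-1 = pt (s / (s ^+ 2 + t ^+ 2)) (- t / (s ^+ 2 + t ^+ 2)).
Proof. by rewrite mulNr. Qed.

Lemma half_inv_le (s t : R) : 0 < s -> `|t| <= s -> (2 * s)^-1 <= s / (s ^+ 2 + t ^+ 2).
Proof.
move=> s0 ts; have t2 : t ^+ 2 <= s ^+ 2.
  by rewrite -(real_normK (num_real t)) lerXn2r ?nnegrE// ltW.
have s2 : 0 < s ^+ 2 by rewrite exprn_gt0.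
have t20 : 0 <= t ^+ 2 by rewrite sqr_ge0.
rewrite ler_pdivlMr ?ltr_wpDr// mulrC ler_pdivrMr ?mulr_gt0//.
rewrite mulrCA -expr2; lra.
Qed.

(* Near the centre [F] is [k / (z - c)] up to [e / |z - c|], and
   [Im (dz / (z - c))] is at least [1 / (2 s)] along each side. *)
Lemma rect_int_square_ge F u v s k e : 0 < s -> 0 <= k -> 0 <= e ->
  (forall x y, u - s <= x <= u + s -> v - s <= y <= v + s ->
     pt x y != pt u v -> exists l, cdiff F (pt x y) l) ->
  (forall z, s <= modulus (z - pt u v) <= 2 * s ->
     modulus (F z - tc k / (z - pt u v)) <= e / s) ->
  4 * k - 8 * e <= rect_int F (u - s) (u + s) (v - s) (v + s).
Proof.
move=> s0 k0 e0 DF Fm.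
have xS : u - s <= u + s by lra. have yS : v - s <= v + s by lra.
have ne x y : x != u \/ y != v -> pt x y != pt u v.
  by move=> xy; apply/eqP => -[xu yv]; case: xy; rewrite ?xu ?yv eqxx.
have Fm' x y : `|x - u| <= s -> `|y - v| <= s -> s <= `|x - u| \/ s <= `|y - v| ->
    modulus (F (pt x y) - tc k / pt (x - u) (y - v)) <= e / s.
  move=> xu yv xy; rewrite -ptB; apply: Fm; rewrite ptB; apply/andP; split.
    case: xy => /le_trans; apply; first exact: Re_le_modulus (pt _ _).
    exact: Im_le_modulus (pt _ _).
  by rewrite (le_trans (modulus_pt _ _))//; lra.
have Re_m x y : `|x - u| <= s -> `|y - v| <= s -> s <= `|x - u| \/ s <= `|y - v| ->
    - (e / s) <= complex.Re (F (pt x y)) - k * ((x - u) / ((x - u) ^+ 2 + (y - v) ^+ 2)) <= e / s.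
  move=> a b c; rewrite -ler_norml; apply: le_trans (Fm' _ _ a b c).
  apply: le_trans (Re_le_modulus _); rewrite inv_pt.
  case: (F _) => p q /=; rewrite mul0r subr0 lexx; exact: isT.
have Im_m x y : `|x - u| <= s -> `|y - v| <= s -> s <= `|x - u| \/ s <= `|y - v| ->
    - (e / s) <= complex.Im (F (pt x y)) - k * (- (y - v) / ((x - u) ^+ 2 + (y - v) ^+ 2)) <= e / s.
  move=> a b c; rewrite -ler_norml; apply: le_trans (Fm' _ _ a b c).
  apply: le_trans (Im_le_modulus _); rewrite inv_pt.
  case: (F _) => p q /=; rewrite mul0r addr0 lexx; exact: isT.
have us : u - s - u = - s by ring.
have us' : u + s - u = s by ring.
have vs : v - s - v = - s by ring.
have vs' : v + s - v = s by ring.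
have ns : `|s| = s by rewrite gtr0_norm.
(* A lower bound for the positively oriented integrand on each side. Four sides of length 2 s give 4
   k - 8 e, where the exact residue would give 2 pi k. *)
pose m := k * (2 * s)^-1 - e / s.
have E1 : m * (u + s - (u - s)) <= hedge F (v - s) (u - s) (u + s).
  apply: oint_ge => // x xP.
    apply: hedge_continuous; apply: DF => //; first by apply/andP; split; lra.
    by apply: ne; right; lra.
  have xus : `|x - u| <= s.
    by rewrite ler_norml; move/andP: xP => [? ?]; apply/andP; split; lra.
  have := Im_m x (v - s) xus; rewrite vs normrN ns => /(_ (lexx _) (or_intror (lexx _))).
  rewrite opprK sqrrN addrC => /andP[H _].
  have := half_inv_le _ _ s0 xus => /(ler_wpM2l k0); rewrite /m [s ^+ 2 + _]addrC; lra.
have E2 : hedge F (v + s) (u - s) (u + s) <= - m * (u + s - (u - s)).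
  apply: oint_le => // x xP.
    apply: hedge_continuous; apply: DF => //; first by apply/andP; split; lra.
    by apply: ne; right; lra.
  have xus : `|x - u| <= s.
    by rewrite ler_norml; move/andP: xP => [? ?]; apply/andP; split; lra.
  have := Im_m x (v + s) xus; rewrite vs' ns => /(_ (lexx _) (or_intror (lexx _))).
  rewrite mulNr mulrN opprK => /andP[_ H].
  have := half_inv_le _ _ s0 xus => /(ler_wpM2l k0); rewrite /m [s ^+ 2 + _]addrC; lra.
have E3 : m * (v + s - (v - s)) <= vedge F (u + s) (v - s) (v + s).
  apply: oint_ge => // y yP.
    apply: vedge_continuous; apply: DF => //; first by apply/andP; split; lra.
    by apply: ne; left; lra.
  have yvs : `|y - v| <= s.
    by rewrite ler_norml; move/andP: yP => [? ?]; apply/andP; split; lra.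
  have := Re_m (u + s) y; rewrite us' ns => /(_ (lexx _) yvs (or_introl (lexx _))).
  move=> /andP[H _].
  have := half_inv_le _ _ s0 yvs => /(ler_wpM2l k0); rewrite /m; lra.
have E4 : vedge F (u - s) (v - s) (v + s) <= - m * (v + s - (v - s)).
  apply: oint_le => // y yP.
    apply: vedge_continuous; apply: DF => //; first by apply/andP; split; lra.
    by apply: ne; left; lra.
  have yvs : `|y - v| <= s.
    by rewrite ler_norml; move/andP: yP => [? ?]; apply/andP; split; lra.
  have := Re_m (u - s) y; rewrite us normrN ns => /(_ (lexx _) yvs (or_introl (lexx _))).
  rewrite sqrrN mulNr mulrN opprK => /andP[_ H].
  have := half_inv_le _ _ s0 yvs => /(ler_wpM2l k0); rewrite /m; lra.
have ms : m * (2 * s) = k - 2 * e by rewrite /m; field; lra.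
have uu : u + s - (u - s) = 2 * s by ring.
have vv : v + s - (v - s) = 2 * s by ring.
move: E1 E2 E3 E4; rewrite uu vv !mulNr ms /rect_int; lra.
Qed.

(** The function a (f z - f c) / (z - c)^2 has a simple pole with residue a l = |l|. Its integral is
    the same on a tiny square, where it is at least 4 |l| - 8 e, and on the square of half-side S,
    where it is at most 16 M / S. With S = rad / 3 this is the constant 12. *)
Lemma cauchy_estimate f c l rad M : 0 < rad ->
  (forall z, modulus (z - c) < rad -> exists m, cdiff f z m) ->
  (forall z, modulus (z - c) < rad -> modulus (f z) <= M) ->
  cdiff f c l -> modulus l * rad <= 12 * M.
Proof.
move=> rad0 Df fM fl.
have [->|l0] := eqVneq l 0.
  rewrite modulus0 mul0r mulr_ge0// (le_trans _ (fM c _)) ?modulus_ge0//.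
  by rewrite subrr modulus0.
have ml0 : 0 < modulus l by rewrite modulus_gt0.
(* [rect_int] sees only an imaginary part, so [l] is first rotated onto the positive real axis. *)
have [a aE ma] : exists2 a, tc (modulus l) = a * l & modulus a = 1.
  exists (tc (modulus l) / l); first by rewrite divfK.
  by rewrite modulusM modulusV modulus_tc (gtr0_norm ml0) divff// gt_eqF.
have M0 : 0 <= M.
  by rewrite (le_trans _ (fM c _)) ?modulus_ge0// subrr modulus0.
(* The square reaches at most to distance 2 S < rad from [c]. *)
pose S := rad / 3; have S0 : 0 < S by rewrite divr_gt0.
pose F z := a * ((f z - f c) * ((z - c)^-1 * (z - c)^-1)).
have DF z : modulus (z - c) < rad -> z != c -> exists m, cdiff F z m.
  move=> zr zc; have [m fm] := Df _ zr.
  have zc0 : z - c != 0 by rewrite subr_eq0.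
  have [n gn] := cdiffV (fun w => w - c) _ _ zc0 (cdiffB _ _ _ _ _ (cdiff_id z) (cdiff_cst c z)).
  have := cdiffM _ _ _ _ _ (cdiff_cst a z) (cdiffM _ _ _ _ _
    (cdiffB _ _ _ _ _ fm (cdiff_cst (f c) z)) (cdiffM _ _ _ _ _ gn gn)).
  by eexists; eassumption.
have [u [v cE]] : exists u v, c = pt u v by case: (c) => u v; exists u, v.
have DFS s : 0 < s -> s <= S -> forall x y, u - s <= x <= u + s -> v - s <= y <= v + s ->
     pt x y != pt u v -> exists l, cdiff F (pt x y) l.
  move=> s0 sS x y /andP[? ?] /andP[? ?]; rewrite -cE => xyc; apply: DF => //.
  rewrite cE ptB (le_lt_trans (modulus_pt _ _))//.
  have : `|x - u| <= S by rewrite ler_norml; apply/andP; split; lra.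
  have : `|y - v| <= S by rewrite ler_norml; apply/andP; split; lra.
  rewrite /S; lra.
have up : rect_int F (u - S) (u + S) (v - S) (v + S) <= 8 * S * (2 * M / S ^+ 2).
  apply: rect_int_square_le => //; first by apply: DFS => //; exact: lexx.
  rewrite -cE => z /andP[zS zS2]; rewrite /F !modulusM ma mul1r !modulusV.
  have zc0 : 0 < modulus (z - c) by lra.
  rewrite -expr2 exprVn; apply: ler_pM; rewrite ?modulus_ge0 ?invr_ge0 ?sqr_ge0//.
    rewrite (le_trans (modulusD _ _))// modulusN mulrDl mul1r lerD// fM//.
      by rewrite /S in zS2; lra.
    by rewrite subrr modulus0.
  by rewrite lef_pV2 ?posrE ?exprn_gt0// lerXn2r ?nnegrE ?modulus_ge0// ltW.
have lo e : 0 < e -> 4 * modulus l - 8 * e <= 8 * S * (2 * M / S ^+ 2).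
  move=> e0; apply: le_trans up.
  have [r r0 rf] := fl _ e0.
  pose s := Num.min S (r / 3).
  have s0 : 0 < s by rewrite lt_min S0 divr_gt0.
  have sS : s <= S by rewrite ge_min lexx.
  have sr : s <= r / 3 by rewrite ge_min lexx orbT.
  rewrite (rect_int_ring _ _ _ _ _ s0 sS); last by apply: DFS => //; exact: lexx.
  apply: rect_int_square_ge => //; [exact: ltW|exact: ltW|exact: DFS|].
  rewrite -cE => z /andP[zs zs2].
  have zr : modulus (z - c) < r by lra.
  have mz0 : 0 < modulus (z - c) by lra.
  have zc0 : z - c != 0 by rewrite -modulus_gt0.
  have -> : F z - tc (modulus l) / (z - c) =
      a * ((f z - f c - l * (z - c)) * ((z - c)^-1 * (z - c)^-1)).
    rewrite aE /F -mulrA -mulrBr; congr (a * _).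
    by rewrite [RHS]mulrBl; congr (_ - _); rewrite -mulrA mulVKf.
  rewrite !modulusM ma mul1r !modulusV.
  apply: le_trans (_ : e * modulus (z - c) * ((modulus (z - c))^-1 / modulus (z - c)) <= _).
    by rewrite ler_wpM2r ?mulr_ge0 ?invr_ge0 ?modulus_ge0// rf.
  rewrite -mulrA mulVKf ?gt_eqF//.
  by rewrite (ler_wpM2l (ltW e0))// lef_pV2.
have ub : 4 * modulus l <= 8 * S * (2 * M / S ^+ 2).
  apply/ler_addgt0Pr => e e0; have := lo (e / 8); rewrite divr_gt0// => /(_ isT); lra.
have E : 8 * S * (2 * M / S ^+ 2) = 16 * M / S by field; lra.
move: ub; rewrite E ler_pdivlMr// /S; lra.
Qed.

End CauchyEstimate.

(** * Poincaré distance *)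

Section PoincareDistance.
Context {R : realType}.
Implicit Types (x y : R -> R) (U : set (CC R)) (rho : CC R -> R).

(** Monotonicity without measurability, from the definition of the integral as a supremum over
    simple functions: nothing is known about the measurability of [rho] along a path. *)
Lemma le_integral_ge0 (f g : R -> R) (a b : R) :
  (forall t, a <= t <= b -> 0 <= f t <= g t) ->
  (\int[lebesgue_measure]_(t in `[a, b]) (f t)%:E <=
   \int[lebesgue_measure]_(t in `[a, b]) (g t)%:E)%E.
Proof.
move=> fg; rewrite !ge0_integralE; last 2 first.
- by move=> t /=; rewrite in_itv /= lee_fin => /fg/andP[h /(le_trans h)].
- by move=> t /=; rewrite in_itv /= lee_fin => /fg/andP[h /(le_trans h)].
apply: ereal_sup_le => _ [h hf <-]; exists h => // t.
apply: le_trans (hf t) _; rewrite !patchE; case: ifPn => // /set_mem /=.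
by rewrite in_itv /= lee_fin => /fg/andP[].
Qed.

(** If G is a primitive of |x'|, the mean value theorem shows that neither G - x nor G + x decreases
    from 0 to 1. *)
Lemma dist_le_integral_speed x : C1 x ->
  (`|x 1 - x 0|%:E <=
   \int[lebesgue_measure]_(t in `[0%R, 1%R]) `|derive1 x t|%:E)%E.
Proof.
move=> [dx cx].
have cn : continuous (fun t => `|derive1 x t|).
  by move=> t; apply: continuous_comp; [exact: cx|exact: norm_continuous].
have [G GP] : exists G, primitive_on 0 1 G (fun t => `|derive1 x t|).
  by apply: exists_primitive => // t _; exact: cn.
rewrite (@continuous_FTC2 _ (fun t => `|derive1 x t|) G 0 1)//; last 3 first.
- exact: continuous_subspaceT.
- have cG t : 0 <= t <= 1 -> {for t, continuous G}.
    move=> tP; apply: differentiable_continuous; apply/derivable1_diffP.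
    by apply: ex_derive; exact: GP.
  split; first by move=> t /[!in_itv]/= /andP[? ?]; apply: ex_derive; apply: GP; rewrite !ltW.
    by apply: cvg_at_right_filter; apply: cG; rewrite lexx ler01.
  by apply: cvg_at_left_filter; apply: cG; rewrite lexx ler01.
- move=> t /[!in_itv]/= /andP[? ?].
  by rewrite derive1E; apply: derive_val; apply: GP; rewrite !ltW.
have dx' : primitive_on 0 1 x (derive1 x).
  by move=> t _; rewrite derive1E; exact: derivableP.
have [c _] := primitive_mvt _ _ _ _ (@ler01 R) (primitiveB _ _ _ _ _ _ GP dx').
have dxN : primitive_on 0 1 (fun t => - x t) (fun t => - derive1 x t).
  by move=> t tP; apply: is_deriveN; exact: dx'.
have [k _] := primitive_mvt _ _ _ _ (@ler01 R) (primitiveB _ _ _ _ _ _ GP dxN).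
rewrite -EFinB lee_fin ler_norml.
have := ler_norm (derive1 x c); have := ler_norm (- derive1 x k); rewrite normrN.
move=> *; apply/andP; split; lra.
Qed.

Lemma path_length_ge rho x y c : 0 <= c -> C1 x -> C1 y ->
  (forall t, 0 <= t <= 1 -> c <= rho (x t +i* y t)%C) ->
  ((c * `|x 1 - x 0|)%:E <= path_length rho x y)%E /\
  ((c * `|y 1 - y 0|)%:E <= path_length rho x y)%E.
Proof.
move=> c0 cx cy crho.
have scale (u : R -> R) : C1 u ->
  (forall t, `|derive1 u t| <= Num.sqrt (derive1 x t ^+ 2 + derive1 y t ^+ 2)) ->
  ((c * `|u 1 - u 0|)%:E <= path_length rho x y)%E.
  move=> cu us; rewrite /path_length.
  apply: le_trans (_ : \int[lebesgue_measure]_(t in `[0%R, 1%R]) (c * `|derive1 u t|)%:E <= _)%E.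
    under eq_integral do rewrite EFinM.
    rewrite ge0_integralZl//; last first.
      apply/measurable_EFinP; apply: measurable_funTS.
      apply: continuous_measurable_fun => t.
      by apply: continuous_comp; [exact: cu.2|exact: norm_continuous].
    by rewrite EFinM lee_wpmul2l ?lee_fin// dist_le_integral_speed.
  apply: le_integral_ge0 => t tP; rewrite mulr_ge0//=.
  by rewrite ler_pM// crho.
split; apply: scale => // t; rewrite -sqrtr_sqr ler_wsqrtr// ?lerDl ?lerDr sqr_ge0//.
Qed.

(** The factor 1/2 comes from treating the coordinates separately: the larger of the two increments
    is at least half of |z - w|. *)
Lemma poincare_dist_ge U rho c z w : 0 <= c ->
  (forall v, U v -> c <= rho v) ->
  ((c / 2 * modulus (z - w))%:E <= poincare_dist U rho z w)%E.
Proof.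
move=> c0 crho; apply: le_ereal_inf_tmp => _ [x [y [cx cy x0 x1 [Uxy ->]]]].
have [|H1 H2] := path_length_ge rho x y c c0 cx cy.
  by move=> t tP; exact/crho/Uxy.
have zw : modulus (z - w) <= `|x 1 - x 0| + `|y 1 - y 0|.
  rewrite -x0 -x1 (distrC (x 1)) (distrC (y 1)).
  exact: modulus_le_ReIm ((x 0 +i* y 0)%C - (x 1 +i* y 1)%C).
have [h|h] := leP `|x 1 - x 0| `|y 1 - y 0|.
  apply: le_trans _ H2; rewrite lee_fin -mulrA ler_wpM2l// mulrC ler_pdivrMr//; lra.
apply: le_trans _ H1; rewrite lee_fin -mulrA ler_wpM2l// mulrC ler_pdivrMr//; lra.
Qed.

(** The Cauchy estimate on the disc of radius 1 - |w| about w bounds the derivative of the covering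
    by 12 M / (1 - |w|), while the density of the unit disk at w is at least 1 / (1 - |w|). *)
Lemma poincare_density_ge U rho M : 0 < M ->
  (forall z, U z -> modulus z <= M) -> poincare_density U rho ->
  forall z, U z -> (12 * M)^-1 <= rho z.
Proof.
move=> M0 UM [f [fholo fU _] rhoE] z; rewrite -fU => -[w w1 <-].
have := rhoE w w1; rewrite /disc_density expr1n mulr1.
have w1' : modulus w < 1 by move: w1; rewrite /disc /= subr0.
have w0 := modulus_ge0 w.
have wn2 : 1 - modulus w ^+ 2 = (1 - modulus w) * (1 + modulus w) by ring.
have dpos : 0 < 1 - modulus w ^+ 2 by rewrite wn2 mulr_gt0//; lra.
move=> E.
have E' : rho (f w) * (modulus (cderiv f w) * (1 - modulus w)) * (1 + modulus w) = 2.
  by rewrite mulrA E -mulrA -wn2 divfK// gt_eqF.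
have sub v : modulus (v - w) < 1 - modulus w -> disc 0 1 v.
  rewrite /disc /= subr0 => vw.
  by rewrite -(subrK w v) (le_lt_trans (modulusD _ _))//; lra.
have C : modulus (cderiv f w) * (1 - modulus w) <= 12 * M.
  apply: (cauchy_estimate f w) => //; first by rewrite subr_gt0.
  - by move=> v /sub v1; exists (cderiv f v); exact/derivable_cdiff/fholo.
  - by move=> v /sub v1; apply: UM; rewrite -fU; exists v.
  - exact/derivable_cdiff/fholo.
set k := _ * (1 - modulus w) in E' C.
have k0 : 0 <= k by rewrite mulr_ge0 ?modulus_ge0//; lra.
have rk : 1 <= rho (f w) * k.
  rewrite -(ler_pM2r (x := 1 + modulus w)); last by lra.
  by rewrite E'; lra.
have r0 : 0 < rho (f w).
  rewrite ltNge; apply/negP => r0.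
  by have := mulr_le0_ge0 r0 k0; lra.
rewrite -[X in X <= _]mul1r ler_pdivrMr ?mulr_gt0//.
by rewrite (le_trans rk)// ler_wpM2l// ltW.
Qed.

Lemma family_dist_cvg U rho r M (f : nat -> R -> CC R -> CC R) phi : 0 < M ->
  (forall z, U z -> modulus z <= M) -> poincare_density U rho ->
  (family_dist U rho r (f n) phi @[n --> \oo] --> 0%E) ->
  forall e : R, 0 < e -> exists n0, forall n t z, (n0 <= n)%N -> disc 0 r z ->
    modulus (f n t z - phi t z) < e.
Proof.
move=> M0 UM rhoP fphi e e0.
pose c := (12 * M)^-1.
have c0 : 0 < c by rewrite invr_gt0 mulr_gt0.
have ce0 : 0 < c / 2 * e by rewrite mulr_gt0// divr_gt0.
have : \forall n \near \oo, (family_dist U rho r (f n) phi < (c / 2 * e)%:E)%E.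
  apply: (fphi [set u | (u < (c / 2 * e)%:E)%E]).
  by apply: open_ereal_lt'; rewrite lte_fin.
move=> [n0 _ n0P]; exists n0 => n t z n0n zr.
have /= := n0P n n0n; apply: contraPP => /negP; rewrite -leNgt => ef.
apply/negP; rewrite -leNgt.
apply: le_trans (_ : poincare_dist U rho (f n t z) (phi t z) <= _)%E; last first.
  by apply: ereal_sup_ubound; exists t, z.
apply: le_trans _ (poincare_dist_ge U rho c _ _ (ltW c0) (poincare_density_ge _ _ _ M0 UM rhoP)).
by rewrite lee_fin ler_wpM2l// divr_ge0// ltW.
Qed.

End PoincareDistance.

(** * A Schwarz lemma for polynomials *)

Section RealPolynomial.
Context {R : realType}.
Implicit Types (p q : {poly R}) (e s : R).

Lemma poly_tail (K : nzRingType) (p : {poly K}) :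
  exists q : {poly K}, p = q * 'X + (p`_0)%:P.
Proof.
elim/poly_ind: p => [|p c _]; first by exists 0; rewrite coef0 mul0r addr0.
by exists p; rewrite coefD coefMX coefC /= add0r.
Qed.

Lemma poly_coef0_ge0 p e : 0 < e -> (forall s, 0 < s < e -> 0 <= p.[s]) -> 0 <= p`_0.
Proof.
move=> e0 pe; rewrite leNgt; apply/negP => p0.
have := @continuous_horner R p 0; rewrite /continuous_at horner_coef0.
move=> /cvgrPdist_lt/(_ (- p`_0)); rewrite oppr_gt0 => /(_ p0).
move=> /nbhs_ballP[k /= k0 kP].
pose s := Num.min e k / 2.
have m0 : 0 < Num.min e k by rewrite lt_min e0.
have me : Num.min e k <= e by rewrite ge_min lexx.
have mk : Num.min e k <= k by rewrite ge_min lexx orbT.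
have s0 : 0 < s by rewrite divr_gt0.
have se : s < e by rewrite /s; lra.
have : 0 <= p.[s] by apply: pe; rewrite s0.
have := kP s; rewrite /ball /= sub0r normrN (gtr0_norm s0) => /(_ _)/ltr_normlP[].
  by rewrite /s; lra.
lra.
Qed.

(** The first- and second-order conditions at a local minimum, obtained by dividing by 'X and then
    'X^2 and letting s tend to 0. *)
Lemma poly_min_coef p e : 0 < e -> p`_0 = 0 ->
  (forall s, `|s| < e -> 0 <= p.[s]) -> p`_1 = 0 /\ 0 <= p`_2.
Proof.
move=> e0 p0 pe; have [q qE] := poly_tail _ p.
have {}qE : p = q * 'X by rewrite {1}qE p0 addr0.
have p1 : p`_1 = q`_0 by rewrite qE coefMX.
have q0 : q`_0 = 0.
  apply/eqP; rewrite eq_le; apply/andP; split.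
    rewrite -oppr_ge0.
    have := @poly_coef0_ge0 (- (q \Po (- 'X))) e e0.
    rewrite coefN -horner_coef0 horner_comp hornerN hornerX oppr0 horner_coef0.
    apply => s /andP[s0 se].
    have := pe (- s); rewrite normrN (gtr0_norm s0) => /(_ se).
    rewrite qE !hornerE horner_comp !hornerE mulrN oppr_ge0 => H.
    by rewrite oppr_ge0 -(pmulr_lle0 _ s0).
  apply: (poly_coef0_ge0 _ e) => // s /andP[s0 se].
  have := pe s; rewrite (gtr0_norm s0) qE hornerM hornerX => /(_ se).
  by rewrite pmulr_lge0.
split; first by rewrite p1.
have [t tE] := poly_tail _ q; have {}tE : q = t * 'X by rewrite {1}tE q0 addr0.
have -> : p`_2 = t`_0 by rewrite qE tE !coefMX.
apply: (poly_coef0_ge0 _ e) => // s /andP[s0 se].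
have := pe s; rewrite (gtr0_norm s0) qE tE !hornerM hornerX => /(_ se).
by rewrite !pmulr_lge0.
Qed.

Lemma coefM1 p q : (p * q)`_1 = p`_0 * q`_1 + p`_1 * q`_0.
Proof. by rewrite coefM !big_ord_recr big_ord0 /= add0r. Qed.

Lemma coefM2 p q : (p * q)`_2 = p`_0 * q`_2 + p`_1 * q`_1 + p`_2 * q`_0.
Proof. by rewrite coefM !big_ord_recr big_ord0 /= add0r. Qed.

(** Coefficientwise parts give the parts of the value at real arguments only ([poly_ReIm]); this
    suffices for restrictions to real lines. *)
Definition RePoly (g : {poly CC R}) : {poly R} :=
  map_poly (fun z : CC R => complex.Re z) g.
Definition ImPoly (g : {poly CC R}) : {poly R} :=
  map_poly (fun z : CC R => complex.Im z) g.

Lemma coef_RePoly (g : {poly CC R}) i : (RePoly g)`_i = complex.Re g`_i.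
Proof. by rewrite coef_map_id0. Qed.

Lemma coef_ImPoly (g : {poly CC R}) i : (ImPoly g)`_i = complex.Im g`_i.
Proof. by rewrite coef_map_id0. Qed.

Lemma Re_mulrn (z : CC R) n : complex.Re (z *+ n) = complex.Re z *+ n.
Proof.
by elim: n => [//|n IH]; rewrite !mulrS -IH; case: z (z *+ n) {IH} => ? ? [].
Qed.

Lemma Im_mulrn (z : CC R) n : complex.Im (z *+ n) = complex.Im z *+ n.
Proof.
by elim: n => [//|n IH]; rewrite !mulrS -IH; case: z (z *+ n) {IH} => ? ? [].
Qed.

Lemma poly_ReIm (g : {poly CC R}) s :
  g.[tc s] = ((RePoly g).[s] +i* (ImPoly g).[s])%C.
Proof.
elim/poly_ind: g => [|g c IH].
  by rewrite /RePoly /ImPoly !map_poly0 !horner0.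
have ReE : RePoly (g * 'X + c%:P) = RePoly g * 'X + (complex.Re c)%:P.
  apply/polyP => i; rewrite coef_RePoly !coefD !coefMX !coefC.
  by case: i => [|i] /=; rewrite ?coef_RePoly ?addr0 ?add0r.
have ImE : ImPoly (g * 'X + c%:P) = ImPoly g * 'X + (complex.Im c)%:P.
  apply/polyP => i; rewrite coef_ImPoly !coefD !coefMX !coefC.
  by case: i => [|i] /=; rewrite ?coef_ImPoly ?addr0 ?add0r.
rewrite ReE ImE !hornerE IH.
case: c {ReE ImE} => a b; apply/eqP; rewrite eq_complex /=.
by rewrite ?(mulr0, mul0r, subr0, addr0, add0r) !eqxx.
Qed.

End RealPolynomial.

(** * Ahlfors' maximum principle for polynomials *)

Section PolynomialSchwarz.
Context {R : realType}.
Implicit Types (z w : CC R) (P : {poly CC R}) (r M : R).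

(* The second-order conditions along [1] and along ['i] at a maximum of
   [A / (|g'| C)] add up to the negativity of the Laplacian of its logarithm,
   to which [|g'|] does not contribute. *)
Lemma laplacian_algebra (r M x0 y0 x1 y1 x2 y2 x3 y3 a b : R) :
  let N1 (A0 A1 B0 B1 C0 C1 : R) :=
    A0 ^+ 2 * (B1 * C0 ^+ 2 + 2 * B0 * C0 * C1) - 2 * A0 * A1 * B0 * C0 ^+ 2 in
  let N2 (A0 A1 A2 B0 B1 B2 C0 C1 : R) :=
    A0 ^+ 2 * (B2 * C0 ^+ 2 + 2 * B1 * C0 * C1 + B0 * (C1 ^+ 2 - 2 * C0)) -
    B0 * C0 ^+ 2 * (2 * A0 * A2 + A1 ^+ 2) in
  let A0 := r ^+ 2 - x0 ^+ 2 - y0 ^+ 2 in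
  let B0 := x1 ^+ 2 + y1 ^+ 2 in
  let C0 := M ^+ 2 - a ^+ 2 - b ^+ 2 in
  let A1 := - (2 * (x0 * x1 + y0 * y1)) in
  let A2 := - (2 * (x0 * x2 + y0 * y2) + B0) in
  let B1 := 4 * (x1 * x2 + y1 * y2) in
  let B2 := 4 * (x2 ^+ 2 + y2 ^+ 2) + 6 * (x1 * x3 + y1 * y3) in
  let C1 := - (2 * a) in
  let A1' := - (2 * (- (x0 * y1) + y0 * x1)) in
  let A2' := - (- (2 * (x0 * x2 + y0 * y2)) + B0) in
  let B1' := 4 * (y1 * x2 - x1 * y2) in
  let B2' := 4 * (x2 ^+ 2 + y2 ^+ 2) - 6 * (x1 * x3 + y1 * y3) in
  let C1' := - (2 * b) in
  0 < A0 -> 0 < B0 -> 0 < C0 ->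
  N1 A0 A1 B0 B1 C0 C1 = 0 -> 0 <= N2 A0 A1 A2 B0 B1 B2 C0 C1 ->
  N1 A0 A1' B0 B1' C0 C1' = 0 -> 0 <= N2 A0 A1' A2' B0 B1' B2' C0 C1' ->
  M ^+ 2 * A0 ^+ 2 <= r ^+ 2 * B0 * C0 ^+ 2.
Proof.
move=> N1 N2 A0 B0 C0 A1 A2 B1 B2 C1 A1' A2' B1' B2' C1' A0p B0p C0p.
(* [N1] and [N2] are the coefficients of order 1 and 2 of A0^2 B C^2 - B0 C0^2 A^2. Division by A0^2
   B0 C0^2 turns them into expressions in logarithmic derivatives. *)
have norm1 (u v t : R) : N1 A0 u B0 v C0 t = 0 -> v / B0 = 2 * (u / A0) - 2 * (t / C0).
  move=> H; apply/eqP; rewrite -subr_eq0; apply/eqP.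
  transitivity (N1 A0 u B0 v C0 t / (A0 ^+ 2 * B0 * C0 ^+ 2)); last by rewrite H mul0r.
  by rewrite /N1; field; rewrite !gt_eqF.
have norm2 (u u2 v v2 t : R) : N2 A0 u u2 B0 v v2 C0 t / (A0 ^+ 2 * B0 * C0 ^+ 2) =
    v2 / B0 + 2 * (v / B0) * (t / C0) + (t / C0) ^+ 2 - 2 / C0
    - 2 * (u2 / A0) - (u / A0) ^+ 2.
  by rewrite /N2; field; rewrite !gt_eqF.
have D0 : 0 < A0 ^+ 2 * B0 * C0 ^+ 2 by rewrite !mulr_gt0// exprn_gt0.
move=> /norm1 e1 h1 /norm1 e2 h2.
have {h1} : 0 <= N2 A0 A1 A2 B0 B1 B2 C0 C1 / (A0 ^+ 2 * B0 * C0 ^+ 2).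
  by rewrite divr_ge0// ltW.
have {h2} : 0 <= N2 A0 A1' A2' B0 B1' B2' C0 C1' / (A0 ^+ 2 * B0 * C0 ^+ 2).
  by rewrite divr_ge0// ltW.
rewrite !norm2 => h2 h1.
(* This is harmonicity of log |g'|: the third-order terms cancel between the two directions, and the
   second-order terms of B become squares of its first-order ones. *)
have B2E : B2 / B0 + B2' / B0 = ((B1 / B0) ^+ 2 + (B1' / B0) ^+ 2) / 2.
  have B0n : x1 ^+ 2 + y1 ^+ 2 != 0 by rewrite -/B0 gt_eqF.
  by rewrite /B2 /B2' /B1 /B1' /B0; field.
have A1E : (A1 / A0) ^+ 2 + (A1' / A0) ^+ 2 = 4 * (x0 ^+ 2 + y0 ^+ 2) * B0 / A0 ^+ 2.
  by rewrite /A1 /A1' /B0; field; rewrite gt_eqF.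
have A2E : A2 / A0 + A2' / A0 = - 2 * B0 / A0.
  by rewrite /A2 /A2'; field; rewrite gt_eqF.
have C1E : (C1 / C0) ^+ 2 + (C1' / C0) ^+ 2 = 4 * (a ^+ 2 + b ^+ 2) / C0 ^+ 2.
  by rewrite /C1 /C1'; field; rewrite gt_eqF.
have key : 0 <= (A1 / A0) ^+ 2 + (A1' / A0) ^+ 2 - ((C1 / C0) ^+ 2 + (C1' / C0) ^+ 2)
    - 4 / C0 + 4 * B0 / A0.
  have -> : 4 * B0 / A0 = - 2 * (A2 / A0 + A2' / A0).
    by rewrite A2E; field; rewrite gt_eqF.
  have := addr_ge0 h1 h2; rewrite [X in 0 <= X -> _](_ : _ =
    B2 / B0 + B2' / B0 + 2 * (B1 / B0) * (C1 / C0) + 2 * (B1' / B0) * (C1' / C0)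
    + ((C1 / C0) ^+ 2 + (C1' / C0) ^+ 2) - 4 / C0 - 2 * (A2 / A0 + A2' / A0)
    - ((A1 / A0) ^+ 2 + (A1' / A0) ^+ 2)); last by field; rewrite !gt_eqF.
  rewrite B2E e1 e2 => H; apply: le_trans H _; rewrite le_eqVlt; apply/orP; left.
  by apply/eqP; field; rewrite !gt_eqF.
move: key; rewrite A1E C1E => key.
(* Up to a factor, the difference of two squared hyperbolic densities: that of the disc of radius r
   pulled back by g, and that of the disc of radius M. *)
have : 0 <= 4 * (r ^+ 2 * B0 / A0 ^+ 2 - M ^+ 2 / C0 ^+ 2).
  apply: le_trans key _; rewrite le_eqVlt; apply/orP; left; apply/eqP.
  have rE : r ^+ 2 = A0 + x0 ^+ 2 + y0 ^+ 2 by rewrite /A0; ring.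
  have ME : M ^+ 2 = C0 + a ^+ 2 + b ^+ 2 by rewrite /C0; ring.
  by rewrite rE ME; field; rewrite !gt_eqF.
rewrite pmulr_rge0// subr_ge0 ler_pdivrMr ?exprn_gt0// mulrAC.
by rewrite ler_pdivlMr ?exprn_gt0.
Qed.

(** On [K] the pullback by P - P z of the hyperbolic metric of the disc of radius r dominates the
    hyperbolic metric of the disc of radius M, which contains [K]: the squared ratio of the
    densities is M^2 / r^2 times [u]. As [A] vanishes where |P - P z| = r, the maximum of [u] lies
    in the interior, where [laplacian_algebra] applies. At [z], A = r^2 and C <= M^2 give the claim.
    Squares keep everything polynomial in the real and imaginary parts. *)
Lemma poly_schwarz P z r M : 0 < r -> 0 < M ->
  (forall w, modulus (P.[w] - P.[z]) <= r -> modulus w < M) ->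
  (forall w, modulus (P.[w] - P.[z]) <= r -> P^`().[w] != 0) ->
  r <= M * modulus P^`().[z].
Proof.
move=> r0 M0 PM Pn0.
pose A w : R := r ^+ 2 - modulus (P.[w] - P.[z]) ^+ 2.
pose B w : R := modulus P^`().[w] ^+ 2.
pose C w : R := M ^+ 2 - modulus w ^+ 2.
pose K : set (CC R) := [set w | modulus (P.[w] - P.[z]) <= r].
have Cp w : K w -> 0 < C w.
  by move=> /PM wM; rewrite subr_gt0 ltrXn2r// ?nnegrE ?modulus_ge0 ?ltW.
have Bp w : K w -> 0 < B w by move=> /Pn0 wn; rewrite exprn_gt0// modulus_gt0.
have Dp w : K w -> 0 < B w * C w ^+ 2.
  by move=> Kw; rewrite mulr_gt0 ?Bp// exprn_gt0 ?Cp.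
pose u w := A w ^+ 2 * (B w * C w ^+ 2)^-1.
have cm : continuous (fun w => modulus (P.[w] - P.[z])).
  move=> w; apply: (@continuous_comp _ _ _ (fun w => P.[w] - P.[z])); last exact: continuous_modulus.
  have -> : (fun w => P.[w] - P.[z]) = horner (P - P.[z]%:P).
    by apply/funext => t; rewrite !hornerE.
  exact: continuous_hornerC.
have csq (f : CC R -> R) : continuous f -> continuous (fun w => f w ^+ 2).
  by move=> cf w; apply: (@continuous_comp _ _ _ f (fun t : R => t ^+ 2)); [exact: cf|exact: exprn_continuous].
have csub (c : R) (f : CC R -> R) : continuous f -> continuous (fun w => c - f w).
  move=> cf w; apply: (@continuous_comp _ _ _ f (fun t : R => c - t)); first exact: cf.
  by apply: (@continuousB _ R^o _ (cst c) id); [exact: cvg_cst|exact: cvg_id].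
have cmul (f h : CC R -> R) : continuous f -> continuous h ->
    continuous (fun w => f w * h w).
  by move=> cf ch w; apply: (@continuousM _ _ f h); [exact: cf|exact: ch].
have cA : continuous A by apply: (csub _ (fun w => _ ^+ 2)); exact: csq.
have cB : continuous B.
  apply: csq => w; apply: (@continuous_comp _ _ _ (horner P^`())).
    exact: continuous_hornerC.
  exact: continuous_modulus.
have cC : continuous C.
  by apply: (csub _ (fun w => _ ^+ 2)); apply: csq; exact: continuous_modulus.
have Kc : compact K.
  apply: (subclosed_compact _ (closed_disc_compact 0 M)); last first.
    by move=> w /PM/ltW; rewrite /= subr0.
  move=> w Kw; rewrite /K /= leNgt; apply/negP => rw.
  have := cm w; move=> /cvgrPdist_lt/(_ (modulus (P.[w] - P.[z]) - r)).
  rewrite subr_gt0 => /(_ rw)/Kw[v [Kv]] /=.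
  by rewrite ltr_norml => /andP[_]; move: Kv; rewrite /K /=; lra.
have Kz : K z by rewrite /K /= subrr modulus0 ltW.
have [m Km mP] : exists2 m, m \in K & forall t, t \in K -> u t <= u m.
  apply: compact_EVT_max => //; first by exists z.
  apply/continuous_in_subspaceT => w /set_mem Kw.
  apply: (@continuousM _ _ (fun w => A w ^+ 2) (fun w => (B w * C w ^+ 2)^-1)).
    exact: csq.
  apply: (@continuousV _ _ (fun w => B w * C w ^+ 2)).
    by rewrite gt_eqF// mulr_gt0 ?Bp// exprn_gt0// Cp.
  by apply: (cmul B (fun w => C w ^+ 2)); [exact: cB|exact: csq].
move: Km => /set_mem Km.
have Az : A z = r ^+ 2 by rewrite /A subrr modulus0 expr0n subr0.
have uz : r ^+ 2 ^+ 2 / (B z * C z ^+ 2) <= u m.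
  by rewrite -Az; apply: mP; exact/mem_set.
have Am : 0 < A m.
  have : 0 < u m.
    apply: lt_le_trans uz; apply: divr_gt0; last exact: Dp.
    by do 2!apply: exprn_gt0.
  have : 0 <= A m.
    by rewrite subr_ge0 lerXn2r// nnegrE ?modulus_ge0// ltW.
  by rewrite /u le_eqVlt => /predU1P[<-|//]; rewrite expr0n mul0r ltxx.
suff key : M ^+ 2 * A m ^+ 2 <= r ^+ 2 * B m * C m ^+ 2.
  have um : u m <= r ^+ 2 / M ^+ 2.
    rewrite /u ler_pdivrMr ?Dp// mulrAC.
    rewrite ler_pdivlMr ?exprn_gt0//; move: key.
    by rewrite [M ^+ 2 * _]mulrC -[r ^+ 2 * _ * _]mulrA.
  have := le_trans uz um.
  rewrite ler_pdivrMr ?Dp// mulrAC.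
  rewrite ler_pdivlMr ?exprn_gt0// expr2 -mulrA ler_pM2l ?exprn_gt0// => H.
  have CM : C z <= M ^+ 2 by rewrite /C lerBlDr lerDl sqr_ge0.
  have : r ^+ 2 * M ^+ 2 <= B z * M ^+ 2 ^+ 2.
    apply: le_trans H _; apply: (ler_wpM2l (ltW (Bp _ Kz))).
    by rewrite lerXn2r// nnegrE ?sqr_ge0//; exact/ltW/Cp.
  rewrite [M ^+ 2 ^+ 2]expr2 mulrA ler_pM2r ?exprn_gt0// /B -exprMn.
  by rewrite ler_pXn2r ?nnegrE ?mulr_ge0 ?modulus_ge0 ?(ltW r0) ?(ltW M0)// mulrC.
pose g := (P - P.[z]%:P) \Po ('X + m%:P).
have gE h : g.[h] = P.[h + m] - P.[z].
  by rewrite /g horner_comp !hornerE.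
have dgE h : g^`().[h] = P^`().[h + m].
  by rewrite /g deriv_comp derivB derivC subr0 derivD derivX derivC addr0 mulr1 horner_comp !hornerE.
(* The conditions for the maximum along the line m + s v, in the Taylor coefficients of the
   restriction [G]; they are used for v = 1 and v = i. The derivatives are compared in modulus
   because G' = v g'. *)
have local (v : CC R) (G : {poly CC R}) : modulus v = 1 ->
    (forall s, G.[tc s] = g.[tc s * v]) ->
    (forall s, modulus G^`().[tc s] = modulus g^`().[tc s * v]) ->
    let x i := complex.Re G`_i in let y i := complex.Im G`_i in
    let q := complex.Re m * complex.Re v + complex.Im m * complex.Im v in
    let A0 := r ^+ 2 - x 0%N ^+ 2 - y 0%N ^+ 2 in
    let B0 := x 1%N ^+ 2 + y 1%N ^+ 2 in
    let C0 := M ^+ 2 - complex.Re m ^+ 2 - complex.Im m ^+ 2 in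
    let A1 := - (2 * (x 0%N * x 1%N + y 0%N * y 1%N)) in
    let A2 := - (2 * (x 0%N * x 2%N + y 0%N * y 2%N) + B0) in
    let B1 := 4 * (x 1%N * x 2%N + y 1%N * y 2%N) in
    let B2 := 4 * (x 2%N ^+ 2 + y 2%N ^+ 2) + 6 * (x 1%N * x 3%N + y 1%N * y 3%N) in
    let C1 := - (2 * q) in
    A0 ^+ 2 * (B1 * C0 ^+ 2 + 2 * B0 * C0 * C1) - 2 * A0 * A1 * B0 * C0 ^+ 2 = 0 /\
    0 <= A0 ^+ 2 * (B2 * C0 ^+ 2 + 2 * B1 * C0 * C1 + B0 * (C1 ^+ 2 - 2 * C0)) -
         B0 * C0 ^+ 2 * (2 * A0 * A2 + A1 ^+ 2).
  move=> v1 GE dGE x y q A0 B0 C0 A1 A2 B1 B2 C1.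
  have v2 : complex.Re v ^+ 2 + complex.Im v ^+ 2 = 1 by rewrite -sqr_modulus v1 expr1n.
  have x'E i : complex.Re G^`()`_i = x i.+1 *+ i.+1.
    by rewrite coef_deriv Re_mulrn.
  have y'E i : complex.Im G^`()`_i = y i.+1 *+ i.+1.
    by rewrite coef_deriv Im_mulrn.
  pose pA := (r ^+ 2)%:P - RePoly G * RePoly G - ImPoly G * ImPoly G.
  pose pB := RePoly G^`() * RePoly G^`() + ImPoly G^`() * ImPoly G^`().
  pose l1 := (complex.Re m)%:P + (complex.Re v) *: 'X.
  pose l2 := (complex.Im m)%:P + (complex.Im v) *: 'X.
  pose pC := (M ^+ 2)%:P - l1 * l1 - l2 * l2.
  have lc (c e : R) : [/\ (c%:P + e *: 'X)`_0 = c, (c%:P + e *: 'X)`_1 = e & (c%:P + e *: 'X)`_2 = 0].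
    by split; rewrite !coefE /= ?mulr0 ?mulr1 ?addr0 ?add0r.
  have [l10 l11 l12] := lc (complex.Re m) (complex.Re v).
  have [l20 l21 l22] := lc (complex.Im m) (complex.Im v).
  have a0 : pA`_0 = A0.
    by rewrite /pA !coefB !coef0M coefC !coef_RePoly !coef_ImPoly /= -!expr2.
  have a1 : pA`_1 = A1.
    by rewrite /pA !coefB !coefM1 coefC !coef_RePoly !coef_ImPoly /= /A1 /x /y; ring.
  have a2 : pA`_2 = A2.
    by rewrite /pA !coefB !coefM2 coefC !coef_RePoly !coef_ImPoly /= /A2 /B0 /x /y; ring.
  have b0 : pB`_0 = B0.
    by rewrite /pB !coefD !coef0M !coef_RePoly !coef_ImPoly !x'E !y'E /B0; ring.
  have b1 : pB`_1 = B1.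
    by rewrite /pB !coefD !coefM1 !coef_RePoly !coef_ImPoly !x'E !y'E /B1; ring.
  have b2 : pB`_2 = B2.
    by rewrite /pB !coefD !coefM2 !coef_RePoly !coef_ImPoly !x'E !y'E /B2; ring.
  have c0 : pC`_0 = C0.
    by rewrite /pC !coefB !coef0M coefC l10 l20 /= -!expr2.
  have c1 : pC`_1 = C1.
    by rewrite /pC !coefB !coefM1 coefC l10 l20 l11 l21 /= /C1 /q; ring.
  have c2 : pC`_2 = - 1.
    by rewrite /pC !coefB !coefM2 coefC l10 l20 l11 l21 l12 l22 /= -v2; ring.
  (* [pN] is the inequality u <= u m with denominators cleared: it vanishes at 0 and is nonnegative
     nearby. *)
  pose k1 := A0 ^+ 2; pose k2 := B0 * C0 ^+ 2.
  pose pN := k1%:P * (pB * (pC * pC)) - k2%:P * (pA * pA).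
  have n0 : pN`_0 = 0.
    by rewrite /pN coefB !coef0M !coefC /= a0 b0 c0 /k1 /k2; ring.
  have n1 : pN`_1 = A0 ^+ 2 * (B1 * C0 ^+ 2 + 2 * B0 * C0 * C1) - 2 * A0 * A1 * B0 * C0 ^+ 2.
    by rewrite /pN coefB !coefCM !(coefM1, coef0M) a0 a1 b0 b1 c0 c1 /k1 /k2; ring.
  have n2 : pN`_2 = A0 ^+ 2 * (B2 * C0 ^+ 2 + 2 * B1 * C0 * C1 + B0 * (C1 ^+ 2 - 2 * C0)) -
         B0 * C0 ^+ 2 * (2 * A0 * A2 + A1 ^+ 2).
    rewrite /pN coefB !coefCM !(coefM2, coefM1, coef0M) a0 a1 a2 b0 b1 b2 c0 c1 c2 /k1 /k2; ring.
  have pAs s : pA.[s] = A (tc s * v + m).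
    rewrite /A -gE -GE poly_ReIm sqr_modulus /= /pA !hornerE; ring.
  have pBs s : pB.[s] = B (tc s * v + m).
    by rewrite /B -dgE -dGE poly_ReIm sqr_modulus /= /pB !hornerE -!expr2.
  have pCs s : pC.[s] = C (tc s * v + m).
    rewrite /C sqr_modulus /pC /l1 /l2 !hornerE.
    case: (v) (m) => v' v'' [m' m''] /=; ring.
  have A0E : A0 = A m by rewrite -a0 -horner_coef0 pAs mul0r add0r.
  have B0E : B0 = B m by rewrite -b0 -horner_coef0 pBs mul0r add0r.
  have C0E : C0 = C m by rewrite -c0 -horner_coef0 pCs mul0r add0r.
  have [e e0 eK] : exists2 e : R, 0 < e & forall w, modulus (w - m) < e -> K w.
    have rm : 0 < r - modulus (P.[m] - P.[z]).
      rewrite subr_gt0 -(ltr_pXn2r (n := 2)) ?nnegrE ?modulus_ge0 ?ltW//.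
      by rewrite -subr_gt0.
    have := cm m => /cvgrPdist_lt/(_ _ rm)/nbhs_modulus[e e0 eP].
    exists e => // w /eP; rewrite /= ltr_norml /K /= => /andP[H _]; lra.
  rewrite -n1 -n2; apply: (poly_min_coef _ e) => // s se.
  have Kw : K (tc s * v + m) by apply: eK; rewrite addrK modulusM modulus_tc v1 mulr1.
  have := mP _ (mem_set Kw).
  rewrite /u ler_pdivrMr ?Dp// mulrAC.
  rewrite ler_pdivlMr ?Dp// => H.
  rewrite /pN hornerD hornerN !hornerM !hornerC pAs pBs pCs subr_ge0 -!expr2.
  by rewrite /k1 /k2 A0E B0E C0E mulrC.
have [g1 g2] := local 1 g modulus1 (fun s => congr1 _ (esym (mulr1 _)))
  (fun s => congr1 (fun t => modulus g^`().[t]) (esym (mulr1 _))).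
pose I : CC R := (0 +i* 1)%C.
have I1 : modulus I = 1 by rewrite /modulus /= expr0n expr1n add0r sqrtr1.
have [] := local I (g \Po (I *: 'X)) I1.
- by move=> s; rewrite horner_comp !hornerE mulrC.
- move=> s; rewrite deriv_comp derivZ derivX alg_polyC hornerM hornerC horner_comp.
  by rewrite hornerZ hornerX modulusM I1 mulr1 [I * _]mulrC.
have cI k : (g \Po (I *: 'X))`_k = I ^+ k * g`_k.
  elim/poly_ind: g k {gE dgE local g1 g2} => [|g c IH] k.
    by rewrite comp_poly0 coef0 mulr0.
  rewrite comp_poly_MXaddC -scalerAr !coefD coefZ !coefMX !coefC.
  by case: k => [|k] /=; rewrite ?mulr0 ?add0r ?expr0 ?mul1r// IH !addr0 mulrA exprS.
rewrite !cI expr0 mul1r expr1.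
have r1 : complex.Re (I * g`_1) = - complex.Im g`_1 by case: (g`_1) => ? ? /=; ring.
have i1 : complex.Im (I * g`_1) = complex.Re g`_1 by case: (g`_1) => ? ? /=; ring.
have r2 : complex.Re (I ^+ 2 * g`_2) = - complex.Re g`_2.
  by rewrite expr2; case: (g`_2) => ? ? /=; ring.
have i2 : complex.Im (I ^+ 2 * g`_2) = - complex.Im g`_2.
  by rewrite expr2; case: (g`_2) => ? ? /=; ring.
have r3 : complex.Re (I ^+ 3 * g`_3) = complex.Im g`_3.
  by rewrite !exprS expr0; case: (g`_3) => ? ? /=; ring.
have i3 : complex.Im (I ^+ 3 * g`_3) = - complex.Re g`_3.
  by rewrite !exprS expr0; case: (g`_3) => ? ? /=; ring.
rewrite r1 i1 r2 i2 r3 i3 /= => g1' g2'.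
have AmE : A m = r ^+ 2 - complex.Re g`_0 ^+ 2 - complex.Im g`_0 ^+ 2.
  by rewrite /A -horner_coef0 gE add0r sqr_modulus; ring.
have BmE : B m = complex.Re g`_1 ^+ 2 + complex.Im g`_1 ^+ 2.
  by rewrite -sqr_modulus /B -[m in LHS]add0r -dgE horner_coef0 coef_deriv.
have CmE : C m = M ^+ 2 - complex.Re m ^+ 2 - complex.Im m ^+ 2.
  by rewrite /C sqr_modulus; ring.
rewrite AmE BmE CmE.
apply: (laplacian_algebra r M _ _ _ _ (complex.Re g`_2) (complex.Im g`_2) (complex.Re g`_3) (complex.Im g`_3)).
- by rewrite -AmE.
- by rewrite -BmE Bp.
- by rewrite -CmE Cp.
- by rewrite -[RHS]g1 /=; ring.
- apply: le_trans g2 _; rewrite le_eqVlt; apply/orP; left; apply/eqP => /=; ring.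
- by rewrite -[RHS]g1' /=; ring.
- apply: le_trans g2' _; rewrite le_eqVlt; apply/orP; left; apply/eqP => /=; ring.
Qed.

End PolynomialSchwarz.

(** * Polynomial dynamics *)

Section ComplexTopology.
Context {R : realType}.
Implicit Types (A B K : set (CC R)) (z w : CC R).

Lemma compact_margin K A : compact K ->
  (forall z, A z -> exists2 e : R, 0 < e & forall w, modulus (w - z) < e -> A w) ->
  K `<=` A -> exists2 e : R, 0 < e &
    forall z w, K z -> modulus (w - z) < e -> A w.
Proof.
move=> /compact_near_coveringP cK oA KA.
have := cK R (0 : R)^'+ (fun e z => forall w, modulus (w - z) < e -> A w) _.
case=> [z Kz|k /= k0 kP].
- have [e e0 eA] := oA _ (KA _ Kz).
  have e2 : 0 < e / 2 by rewrite divr_gt0.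
  exists ([set w | modulus (w - z) < e / 2], [set t | 0 < t < e / 2]).
    split; first by apply/nbhs_modulus; exists (e / 2).
    by near=> t; apply/andP; split; near: t; [exact: nbhs_right_gt|exact: nbhs_right_lt].
  move=> [w t] /= [wz /andP[t0 te]] v vw; apply: eA.
  by rewrite (le_lt_trans (modulus_triB v w z))// (splitr e) ltrD// (lt_trans vw).
- exists (k / 2); first by rewrite divr_gt0.
  move=> z w Kz; apply: (kP (k / 2)) => //=.
    by rewrite /ball_ /= sub0r normrN gtr0_norm ?divr_gt0// ltr_pdivrMr//; lra.
  by rewrite divr_gt0.
Unshelve. all: by end_near. Qed.

Lemma closure_modulus A z : closure A z <->
  forall e : R, 0 < e -> exists2 w, A w & modulus (w - z) < e.
Proof.
split=> [Az e e0|Az B /nbhs_modulus[e e0 eB]].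
  have [w [Aw wz]] : A `&` [set w | modulus (w - z) < e] !=set0.
    by apply: Az; apply/nbhs_modulus; exists e.
  by exists w.
by have [w Aw wz] := Az e e0; exists w; split => //; exact: eB.
Qed.

Lemma closure_image (f : CC R -> CC R) A z : {for z, continuous f} ->
  closure A z -> closure (f @` A) (f z).
Proof.
move=> cf Az B /cf fB; have [w [Aw Bw]] := Az _ fB.
by exists (f w); split => //; exists w.
Qed.

(** Closure commutes with finite unions; through this lemma the finiteness of the attracting cycles
    enters [Delta_margin]. *)
Lemma closure_seq_bigcup (s : seq (CC R)) (F : CC R -> set (CC R)) z :
  closure [set w | exists2 c, c \in s & F c w] z ->
  exists2 c, c \in s & closure (F c) z.
Proof.
elim: s => [|c s IH].
  by move=> /closure_modulus/(_ _ ltr01)[w [c]]; rewrite in_nil.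
have -> : [set w | exists2 c0, c0 \in c :: s & F c0 w] =
    F c `|` [set w | exists2 c0, c0 \in s & F c0 w].
  apply/seteqP; split => w /=.
    by move=> [c0]; rewrite in_cons => /predU1P[->|cs] Fw; [left|right; exists c0].
  by move=> [Fw|[c0 cs Fw]]; [exists c; rewrite ?mem_head|exists c0; rewrite ?in_cons ?cs ?orbT].
rewrite closureU => -[cz|/IH[c0 cs cz]]; first by exists c; rewrite ?mem_head.
by exists c0; rewrite ?in_cons ?cs ?orbT.
Qed.

End ComplexTopology.

(** * Iterates, cycles and basins of a polynomial *)

Section PolynomialDynamics.
Context {R : realType} (p : {poly CC R}).
Implicit Types (z w c : CC R) (n k j : nat).

Definition iterp n : {poly CC R} := iter n (fun q => p \Po q) 'X.

Lemma piterE n : piter p n = horner (iterp n).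
Proof.
apply/funext => z; elim: n => [|n IH]; first by rewrite /= hornerX.
by rewrite [iterp _]/= horner_comp -IH.
Qed.

Lemma piterD m n z : piter p (m + n) z = piter p m (piter p n z).
Proof. exact: iterD. Qed.

Lemma piterS n z : piter p n.+1 z = p.[piter p n z].
Proof. by []. Qed.

Lemma piterSr n z : piter p n.+1 z = piter p n p.[z].
Proof. exact: iterSr. Qed.

Lemma continuous_piter n : continuous (piter p n).
Proof. by rewrite piterE; exact: continuous_hornerC. Qed.

Lemma deriv_iterp n z : (iterp n)^`().[z] = \prod_(j < n) p^`().[piter p j z].
Proof.
elim: n => [|n IH]; first by rewrite big_ord0 derivX hornerC.
by rewrite big_ord_recr /= deriv_comp hornerM IH horner_comp piterE mulrC.
Qed.

Lemma cderiv_piter n z : cderiv (piter p n) z = \prod_(j < n) p^`().[piter p j z].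
Proof. by rewrite piterE (cdiff_cderiv _ _ _ (cdiff_horner _ _)) deriv_iterp. Qed.

Section Periodic.
Variables (k : nat) (z : CC R).
Hypothesis pz : piter p k z = z.

Lemma piter_mulk n : piter p (k * n) z = z.
Proof. by elim: n => [|n IH]; rewrite ?muln0// mulnS piterD IH. Qed.

Lemma piter_Dmulk m n : piter p (m + k * n) z = piter p m z.
Proof. by rewrite piterD piter_mulk. Qed.

Lemma piter_mod m : piter p m z = piter p (m %% k) z.
Proof. by rewrite {1}(divn_eq m k) addnC mulnC piter_Dmulk. Qed.

Lemma multiplier_mulk n :
  \prod_(j < k * n) p^`().[piter p j z] = (\prod_(j < k) p^`().[piter p j z]) ^+ n.
Proof.
elim: n => [|n IH]; first by rewrite muln0 big_ord0.
rewrite exprS -IH mulnS big_split_ord /=; congr (_ * _).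
by apply: eq_bigr => j _; rewrite addnC piterD pz.
Qed.

End Periodic.

(** The multiplier is the product of p' along the cycle, and moving one step along the cycle
    permutes the factors cyclically. *)
Lemma attracting_piter j z : attracting p z -> attracting p (piter p j z).
Proof.
move=> [k [k0 pz lz]]; elim: j => [|j [k' [k'0 pz' lz']]]; first by exists k.
have pS : piter p k' (piter p j.+1 z) = piter p j.+1 z.
  by rewrite piterS -piterSr piterS pz'.
exists k'; split; [exact: k'0|exact: pS|].
move: lz'; rewrite !cderiv_piter.
have -> : \prod_(i < k') p^`().[piter p i (piter p j.+1 z)] =
    \prod_(i < k') p^`().[piter p i.+1 (piter p j z)].
  by apply: eq_bigr => i _; rewrite [in RHS]piterSr.
case: k' k'0 pz' {pS} => [//|n] _ pz'.
rewrite [in X in _ -> X]big_ord_recr /= -piterS pz'.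
by rewrite big_ord_recl /= mulrC.
Qed.

Lemma basin_back z c k m : piter p k z = z -> (0 < k)%N ->
  basin p z (piter p m c) -> basin p z c.
Proof.
(* The period is now [k.+1]: the phase gains k m, which together with the delay m of the orbit makes
   m full periods. *)
case: k => // k pz _ [j jP]; exists (j + k * m)%N.
rewrite -(@cvg_shiftn m _ (fun n => modulus (piter p n c - piter p (n + (j + k * m)) z))).
apply: cvg_trans jP; apply: near_eq_cvg; near=> n => /=.
have -> : (n + m + (j + k * m) = n + j + k.+1 * m)%N by lia.
by rewrite (piterD n m c) (piter_Dmulk _ _ pz).
Unshelve. all: by end_near. Qed.

(** At times divisible by both periods the two cycles stand at p^j z and p^i w. The orbit of c is
    asymptotic to both, so they are equal; i (l - 1) further steps lead from p^i w back to w. *)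
Lemma same_basin z w c k l : piter p k z = z -> (0 < k)%N ->
  piter p l w = w -> (0 < l)%N -> basin p z c -> basin p w c ->
  exists m, w = piter p m z.
Proof.
move=> pz k0 pw l0 [j jP] [i iP].
have eq0 : piter p j z = piter p i w.
  apply/eqP; rewrite -subr_eq0 -normr_eq0 normCE.
  rewrite (_ : modulus _ = 0)//; apply/eqP; rewrite eq_le modulus_ge0 andbT.
  apply/ler_addgt0Pr => e e0; rewrite add0r.
  have e2 : 0 < e / 2 by rewrite divr_gt0.
  have [n1 _ H1] := (@cvgrPdist_lt _ _ _ _ _ _ _).1 jP _ e2.
  have [n2 _ H2] := (@cvgrPdist_lt _ _ _ _ _ _ _).1 iP _ e2.
  pose n := (k * (l * (n1 + n2)))%N.
  have kl : (0 < k * l)%N by rewrite muln_gt0 k0.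
  have nn : (n1 + n2 <= n)%N by rewrite /n mulnA leq_pmull.
  have := H1 n (leq_trans (leq_addr _ _) nn).
  have := H2 n (leq_trans (leq_addl _ _) nn).
  rewrite /= !sub0r !normrN !ger0_norm ?modulus_ge0//.
  have -> : piter p (n + j) z = piter p j z by rewrite addnC /n piter_Dmulk.
  have -> : piter p (n + i) w = piter p i w by rewrite addnC /n mulnCA piter_Dmulk.
  move=> h2 h1; have := modulus_triB (piter p j z) (piter p n c) (piter p i w).
  by rewrite (modulusB _ (piter p n c)); lra.
exists (i * l.-1 + j)%N.
rewrite piterD eq0 -piterD -{1}(piter_mulk _ _ pw i); congr (piter p _ w).
by case: l l0 {pw} => // l _ /=; lia.
Qed.

Lemma poly_large (q : {poly CC R}) (B : R) : (1 < size q)%N ->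
  exists2 r : R, 0 < r & forall z, r <= modulus z -> B <= modulus q.[z].
Proof.
elim/poly_ind: q B => [|q c IH] B; first by rewrite size_poly0.
have tri a z : 0 < a -> a <= modulus q.[z] -> (`|B| + modulus c + 1) / a <= modulus z ->
    B <= modulus (q * 'X + c%:P).[z].
  move=> a0 aq az; rewrite !hornerE.
  have := modulusBl (q.[z] * z) (- c); rewrite opprK modulusN modulusM.
  have : a * modulus z <= modulus q.[z] * modulus z by rewrite ler_wpM2r ?modulus_ge0.
  by move: az; rewrite ler_pdivrMr// [_ * a]mulrC; have := ler_norm B; lra.
have Bc : 0 < `|B| + modulus c + 1 by rewrite ltr_wpDl// addr_ge0// modulus_ge0.
have [sq _|sq] := ltnP 1 (size q).
  have [r r0 rP] := IH 1 sq; exists (r + (`|B| + modulus c + 1)); first exact: addr_gt0.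
  move=> z rz; apply: (tri 1) => //; last by rewrite divr1; lra.
  by apply: rP; lra.
move: sq tri => /size1_polyC ->; set a := q`_0 => tri.
have [->|a0 _] := eqVneq a 0.
  by rewrite mul0r add0r ltnNge size_polyC_leq1.
have ma : 0 < modulus a by rewrite modulus_gt0.
exists ((`|B| + modulus c + 1) / modulus a); first exact: divr_gt0.
by move=> z rz; apply: (tri (modulus a)) => //; rewrite hornerC.
Qed.

(** The factor 3 leaves a factor 2 after the term a y of the Hénon map is subtracted in
    [henon_escape]. *)
Lemma poly_escape : (2 < size p)%N ->
  exists2 r : R, 0 < r & forall z, r <= modulus z -> 3 * modulus z <= modulus p.[z].
Proof.
move=> sp; have [q qE] := poly_tail _ p.
have sq : (1 < size q)%N.
  rewrite ltnNge; apply/negP => sq; move: sp; rewrite qE ltnNge.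
  rewrite (leq_trans (size_polyD _ _))// geq_max (leq_trans (size_polyMleq _ _)).
    by rewrite (leq_trans (size_polyC_leq1 _)).
  by rewrite size_polyX addn2 /= ltnS.
have [r r0 rP] := poly_large q 4 sq.
exists (r + modulus p`_0); first by rewrite ltr_pwDl// modulus_ge0.
move=> z rz; have m0 := modulus_ge0 p`_0.
have /rP qz : r <= modulus z by lra.
rewrite {1}qE !hornerE.
have := modulusBl (q.[z] * z) (- p`_0); rewrite opprK modulusN modulusM.
have : 4 * modulus z <= modulus q.[z] * modulus z by rewrite ler_wpM2r ?modulus_ge0.
lra.
Qed.

End PolynomialDynamics.

(** * Finiteness of the attracting cycles and the trapping margin *)

Section AttractingCycles.
Context {R : realType} (p : {poly CC R}).
Hypothesis size_p : (2 < size p)%N.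
Implicit Types (z w c : CC R) (n k j : nat).

Lemma escape_piter (r : R) z : 0 < r ->
  (forall w, r <= modulus w -> 3 * modulus w <= modulus p.[w]) ->
  r <= modulus z -> forall n, 3 ^+ n * modulus z <= modulus (piter p n z).
Proof.
move=> r0 rP rz; elim=> [|n IH]; first by rewrite expr0 mul1r.
have rn : r <= modulus (piter p n z).
  rewrite (le_trans _ IH)// (le_trans rz)// ler_peMl ?modulus_ge0//.
  by rewrite exprn_ege1// ler1n.
rewrite piterS exprS -mulrA (le_trans _ (rP _ rn))//.
by rewrite ler_pM2l.
Qed.

Lemma filled_julia_bounded : exists2 r : R, 0 < r &
  forall z, filled_julia p z -> modulus z < r.
Proof.
have [r r0 rP] := poly_escape p size_p; exists r => // z [M zM].
rewrite ltNge; apply/negP => rz.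
have /(_ _) Mz n : 3 ^+ n * r <= M.
  rewrite (le_trans _ (zM n))// (le_trans _ (escape_piter _ _ r0 rP rz n))//.
  by rewrite ler_wpM2l// exprn_ge0.
pose n := (Num.truncn (M / r)).+1.
have := Mz n; rewrite -ler_pdivlMr// leNgt => /negP; apply.
apply: lt_le_trans (truncnS_gt _) _.
by rewrite -natrX ler_nat ltnW// ltn_expl.
Qed.

Lemma critical_in_basin z k (r : R) : (0 < k)%N -> piter p k z = z ->
  modulus (cderiv (piter p k) z) < 1 -> 0 < r ->
  (forall w, modulus (w - z) <= r -> basin p z w) ->
  exists2 c, critical_point p c & basin p z c.
Proof.
move=> k0 pz lz r0 rz; apply: contrapT => nocrit.
have [M0 M00 M0P] := poly_escape p size_p.
(* Beyond modulus M the orbit keeps growing and cannot come within r of z; so M bounds the preimages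
   of the disc under all iterates at once. *)
pose M := M0 + modulus z + r.
have Mp : 0 < M by rewrite ltr_wpDl ?addr_ge0 ?modulus_ge0 ?ltW.
pose l := \prod_(j < k) p^`().[piter p j z].
have lower n : r <= M * modulus l ^+ n.
  have PzE : (iterp p (k * n)).[z] = z by rewrite -piterE piter_mulk.
  have dE : (iterp p (k * n))^`().[z] = l ^+ n.
    by rewrite deriv_iterp (multiplier_mulk _ _ _ pz).
  have := poly_schwarz (iterp p (k * n)) z r M r0 Mp.
  rewrite PzE dE modulusX; apply.
  - move=> w; rewrite -piterE => wr; rewrite ltNge; apply/negP => Mw.
    have Mw0 : M0 <= modulus w by have := modulus_ge0 z; rewrite /M in Mw; lra.
    have := escape_piter _ _ M00 M0P Mw0 (k * n).
    have h3 : 1 <= 3 ^+ (k * n) :> R by rewrite exprn_ege1// ler1n.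
    have := ler_peMl (modulus_ge0 w) h3.
    have := modulusBl (piter p (k * n) w) z.
    by rewrite /M in Mw; lra.
  - move=> w; rewrite -piterE deriv_iterp => wr; apply/prodf_neq0 => j _.
    apply/negP => /eqP cj; apply: nocrit; exists (piter p j w).
      by rewrite /critical_point /= /root cj.
    (* A critical point p^j w reaches the disc about z after the remaining k n - j steps, hence lies
       in the basin. *)
    apply: (basin_back _ _ _ _ (k * n - j) pz k0); apply: rz.
    by rewrite -piterD subnK// ltnW.
have l1 : modulus l < 1 by move: lz; rewrite cderiv_piter.
have : (fun n => modulus l ^+ n) @ \oo --> (0 : R).
  by apply: cvg_expr; rewrite ger0_norm ?modulus_ge0.
have rM : 0 < r / M by rewrite divr_gt0.
move=> /cvgrPdist_lt/(_ _ rM)[n _ /(_ n (leqnn n))] /=.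
rewrite sub0r normrN ger0_norm ?exprn_ge0 ?modulus_ge0//.
by rewrite ltr_pdivlMr// mulrC ltNge lower.
Qed.

Variable eps : CC R -> R.
Hypothesis eps_trapping : trapping_radii p eps.

Lemma cycle_nbhd_basin z : attracting p z -> cycle_nbhd p eps z `<=` basin p z.
Proof.
move=> /eps_trapping[_ sub _] w /sub[j _].
exact: connected_component_sub.
Qed.

Lemma disc_cycle_nbhd z : disc z (eps z) `<=` cycle_nbhd p eps z.
Proof. by move=> w zw; exists 0%N. Qed.

Lemma attracting_critical z : attracting p z ->
  exists2 c, critical_point p c & basin p z c.
Proof.
move=> az; have [e0 _ _] := eps_trapping _ az; case: (az) => k [k0 pz lz].
apply: (critical_in_basin _ _ (eps z / 2) k0 pz lz); first by rewrite divr_gt0.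
move=> w zw; apply: cycle_nbhd_basin => //; apply: disc_cycle_nbhd.
by rewrite /disc /= (le_lt_trans zw)// ltr_pdivrMr// ltr_pMr// ltr1n.
Qed.

(* Fatou: every attracting cycle attracts one of the finitely many critical
   points, and a critical point is attracted by at most one cycle. *)
Lemma attracting_finite : exists s : seq (CC R), forall z, attracting p z -> z \in s.
Proof.
have [rs rsE] := closed_field_poly_normal p^`().
have p'0 : p^`() != 0.
  apply/eqP => /(congr1 (fun q : {poly CC R} => q`_(size p).-2)) /eqP.
  have sp : (size p).-2.+1 = (size p).-1 by case: (size p) size_p => [|[|n]].
  rewrite coef_deriv coef0 sp mulrn_eq0 -lead_coefE lead_coef_eq0 -size_poly_eq0.
  by case: (size p) size_p => [|[|n]].
have critE c : critical_point p c -> c \in rs.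
  rewrite /critical_point /= rsE rootZ ?lead_coef_eq0//.
  by rewrite root_prod_XsubC.
have orb c : exists s : seq (CC R), forall z, attracting p z -> basin p z c -> z \in s.
  have [[z [az zc]]|no] := pselect (exists z, attracting p z /\ basin p z c); last first.
    by exists [::] => z az zc; case: no; exists z.
  have [k [k0 pz _]] := az.
  exists [seq piter p m z | m <- iota 0 k] => w [l [l0 pw _]] wc.
  have [m ->] := same_basin _ _ _ _ _ _ pz k0 pw l0 zc wc.
  by rewrite (piter_mod _ _ _ pz); apply/mapP; exists (m %% k)%N; rewrite // mem_iota ltn_mod.
have [S SP] := choice orb.
exists (flatten [seq S c | c <- rs]) => z az.
have [c /critE crs zc] := attracting_critical _ az.
by apply/flatten_mapP; exists c => //; exact: SP.
Qed.

Lemma cycle_nbhd_Delta z : attracting p z -> cycle_nbhd p eps z `<=` Delta p eps.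
Proof.
by move=> az w [j _ zw]; exists (piter p j z); [exact: attracting_piter|exact: zw].
Qed.

(** Each p(V_i) has compact closure in the open V_i, which leaves a margin, and finitely many cycles
    have a positive least margin. It starts from the closure of Delta because [domU] removes the
    closure of the preimage of Delta. *)
Lemma Delta_margin : exists2 e : R, 0 < e &
  forall z w, closure (Delta p eps) z -> modulus (w - p.[z]) < e -> Delta p eps w.
Proof.
have [s sP] := attracting_finite.
have marg z : exists e : R, 0 < e /\ (attracting p z -> forall v w,
    closure (horner p @` cycle_nbhd p eps z) v -> modulus (w - v) < e -> Delta p eps w).
  have [az|naz] := pselect (attracting p z); last by exists 1; split.
  have [_ _ [cK Ksub]] := eps_trapping _ az.
  have [|e e0 eP] := compact_margin _ (cycle_nbhd p eps z) cK _ Ksub.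
    move=> w [j _ jw]; exists (eps (piter p j z) - modulus (w - piter p j z)).
      by rewrite subr_gt0.
    move=> v vw; exists j => //; rewrite /disc /=.
    by rewrite (le_lt_trans (modulus_triB v w _))//; lra.
  exists e; split; first exact: e0.
  by move=> _ v w vK vw; apply: (cycle_nbhd_Delta _ az); exact: eP vK vw.
have {marg}[e eP] := choice marg.
pose m := \big[Num.min/1]_(z <- s) e z.
have me z : z \in s -> m <= e z by move=> zs; rewrite /m; exact: ge_bigmin_seq.
have m0 : 0 < m.
  by rewrite /m; elim/big_ind: _ => // [x y x0 y0|z _]; [rewrite lt_min x0|case: (eP z)].
exists m; [exact: m0|move=> z w Dz wz].
(* [s] may contain other points, so the union remembers [attracting p c]; it is recovered below
   because a piece with a point in its closure is nonempty. *)
have : closure [set w | exists2 c, c \in s & (attracting p c /\ disc c (eps c) w)] z.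
  apply: closure_subset Dz => v [c ac cv]; exists c; last by [].
  exact: sP.
move=> /closure_seq_bigcup[c cs cz].
have ac : attracting p c by have [v [[]]] := cz _ filterT.
have [_ /(_ ac)] := eP c; apply; last by apply: lt_le_trans wz _; exact: me.
apply: closure_image; first exact: continuous_hornerC.
by apply: closure_subset cz => v [_]; exact: disc_cycle_nbhd.
Qed.

End AttractingCycles.

(** * Hénon maps *)

Section RealDerivative.
Context {R : realType}.

Lemma is_derive_approx (g : R -> R) (s c : R) :
  (forall e : R, 0 < e -> exists2 k : R, 0 < k &
     forall t, `|t - s| < k -> `|g t - g s - c * (t - s)| <= e * `|t - s|) ->
  is_derive s 1 g c.
Proof.
move=> gP.
suff H : h^-1 *: (g (h *: 1 + s) - g s) @[h --> 0^'] --> c.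
  by split; [apply/cvg_ex; exists c|exact: cvg_lim H].
apply/cvgrPdist_lt => e e0; have e2 : 0 < e / 2 by rewrite divr_gt0.
have [k k0 kg] := gP _ e2.
apply/nbhs_ballP; exists k => //= h; rewrite /ball /= sub0r normrN => hk h0.
have := kg (h + s); rewrite addrK => /(_ hk) H.
rewrite /GRing.scale /= mulr1 distrC.
have hm : 0 < `|h| by rewrite normr_gt0.
rewrite -(ltr_pM2r hm) -normrM mulrBl mulrAC mulVf// mul1r.
by rewrite (le_lt_trans H)// ltr_pM2r// ltr_pdivrMr// ltr_pMr// ltr1n.
Qed.

(* The constant 2 comes from treating real and imaginary parts separately. *)
Lemma lipschitz_disc (f : CC R -> CC R) (r : R) :
  holomorphic_on (disc 0 r) f ->
  (forall z, disc 0 r z -> modulus (cderiv f z) <= 1) ->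
  forall z w, disc 0 r z -> disc 0 r w -> modulus (f z - f w) <= 2 * modulus (z - w).
Proof.
move=> hf f1 z w zr wr.
pose l (s : R) := w + tc s * (z - w).
have lr s : 0 <= s <= 1 -> disc 0 r (l s).
  move=> /andP[s0 s1]; move: zr wr; rewrite /disc /= !subr0 => zr wr.
  have -> : l s = tc (1 - s) * w + tc s * z.
    rewrite /l /tc; case: (z) (w) => [a b] [c e].
    by apply/eqP; rewrite eq_complex /=; apply/andP; split; apply/eqP; ring.
  rewrite (le_lt_trans (modulusD _ _))// !modulusM !modulus_tc.
  rewrite (ger0_norm s0) ger0_norm; last by lra.
  have [->|s0'] := eqVneq s 0; first by rewrite subr0 mul0r addr0 mul1r.
  have : s * modulus z < s * r by rewrite ltr_pM2l// lt_def s0'.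
  have : (1 - s) * modulus w <= (1 - s) * r by rewrite ler_wpM2l ?(ltW wr)//; lra.
  lra.
have lB s t : l t - l s = tc (t - s) * (z - w).
  rewrite /l /tc; case: (z) (w) => [a b] [c e].
  by apply/eqP; rewrite eq_complex /=; apply/andP; split; apply/eqP; ring.
have appr s : 0 <= s <= 1 -> forall e : R, 0 < e -> exists2 k : R, 0 < k &
    forall t, `|t - s| < k ->
    modulus (f (l t) - f (l s) - cderiv f (l s) * (z - w) * tc (t - s)) <= e * `|t - s|.
  move=> /lr ls e e0.
  have m1 : 0 < modulus (z - w) + 1 by rewrite ltr_wpDl// modulus_ge0.
  have [k k0 kf] := derivable_cdiff _ _ (hf _ ls) (e / (modulus (z - w) + 1)) (divr_gt0 e0 m1).
  exists (k / (modulus (z - w) + 1)); first exact: divr_gt0.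
  move=> t ts; have := kf (l t); rewrite lB modulusM modulus_tc.
  have tk : `|t - s| * modulus (z - w) < k.
    rewrite (le_lt_trans (_ : _ <= `|t - s| * (modulus (z - w) + 1)))//.
      by rewrite ler_wpM2l// lerDl.
    by rewrite -ltr_pdivlMr.
  rewrite -(mulrA _ (z - w)) (mulrC (z - w)) => /(_ tk) /le_trans; apply.
  rewrite -mulrA (ler_wpM2l (ltW e0))// mulrCA ler_piMr//.
  by rewrite mulrC ler_pdivrMr// mul1r lerDl.
have ReB (u v : CC R) : complex.Re (u - v) = complex.Re u - complex.Re v.
  by case: u v => ? ? [].
have ImB (u v : CC R) : complex.Im (u - v) = complex.Im u - complex.Im v.
  by case: u v => ? ? [].
have ReT (u : CC R) (t : R) : complex.Re (u * tc t) = complex.Re u * t.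
  by case: u => a b /=; ring.
have ImT (u : CC R) (t : R) : complex.Im (u * tc t) = complex.Im u * t.
  by case: u => a b /=; ring.
have pR : primitive_on 0 1 (fun s => complex.Re (f (l s)))
    (fun s => complex.Re (cderiv f (l s) * (z - w))).
  move=> s s01; apply: is_derive_approx => e e0.
  have [k k0 kP] := appr s s01 e e0; exists k => // t /kP; apply: le_trans.
  by rewrite -ReT -!ReB; exact: Re_le_modulus.
have pI : primitive_on 0 1 (fun s => complex.Im (f (l s)))
    (fun s => complex.Im (cderiv f (l s) * (z - w))).
  move=> s s01; apply: is_derive_approx => e e0.
  have [k k0 kP] := appr s s01 e e0; exists k => // t /kP; apply: le_trans.
  by rewrite -ImT -!ImB; exact: Im_le_modulus.
have l1 : l 1 = z.
  rewrite /l /tc; case: (z) (w) => [a b] [c e].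
  by apply/eqP; rewrite eq_complex /=; apply/andP; split; apply/eqP; ring.
have l0 : l 0 = w by rewrite /l mul0r addr0.
have dle s : 0 <= s <= 1 -> modulus (cderiv f (l s) * (z - w)) <= modulus (z - w).
  by move=> /lr/f1 fs; rewrite modulusM ler_piMl ?modulus_ge0.
have [c1 /dle c1P] := primitive_mvt _ _ _ _ (@ler01 R) pR.
have [c2 /dle c2P] := primitive_mvt _ _ _ _ (@ler01 R) pI.
rewrite l1 l0 !subr0 !mulr1 => eI eR.
apply: le_trans (modulus_le_ReIm _) _; rewrite ReB ImB eI eR mulr2n mulrDl !mul1r.
apply: lerD; [apply: le_trans c1P; exact: Re_le_modulus|].
by apply: le_trans c2P; exact: Im_le_modulus.
Qed.

End RealDerivative.

(** * Shadowing of p by Hénon maps over a fixed number of steps *)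

Section HenonPerturbation.
Context {R : realType} (p : {poly CC R}) (r : R).
Hypothesis r0 : 0 < r.
Implicit Types (a z w : CC R) (v : CC R * CC R) (n : nat).

Lemma poly_bound (q : {poly CC R}) (B : R) : exists2 L : R, 0 < L &
  forall z, modulus z <= B -> modulus q.[z] <= L.
Proof.
elim/poly_ind: q => [|q c [L L0 LP]].
  by exists 1 => // z _; rewrite horner0 modulus0.
exists (L * (`|B| + 1) + modulus c).
  by rewrite ltr_wpDr ?modulus_ge0// mulr_gt0// ltr_wpDl.
move=> z zB; rewrite !hornerE (le_trans (modulusD _ _))// lerD2r modulusM.
apply: ler_pM; rewrite ?modulus_ge0 ?LP//.
by rewrite (le_trans zB)//; have := ler_norm B; lra.
Qed.

Lemma poly_lipschitz (q : {poly CC R}) (B : R) : exists2 L : R, 0 < L &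
  forall z w, modulus z <= B -> modulus w <= B ->
    modulus (q.[z] - q.[w]) <= L * modulus (z - w).
Proof.
elim/poly_ind: q => [|q c [L L0 LP]].
  by exists 1 => // z w _ _; rewrite !horner0 subrr modulus0 mul1r modulus_ge0.
have [M M0 MP] := poly_bound q B.
exists (L * (`|B| + 1) + M); first by rewrite addr_gt0// mulr_gt0// ltr_wpDl.
move=> z w zB wB; rewrite !hornerE.
have -> : q.[z] * z + c - (q.[w] * w + c) = (q.[z] - q.[w]) * z + q.[w] * (z - w) by ring.
apply: le_trans (modulusD _ _) _; rewrite !modulusM [leRHS]mulrDl.
apply: lerD; last by rewrite ler_wpM2r ?modulus_ge0// MP.
rewrite mulrAC; apply: ler_pM; rewrite ?modulus_ge0 ?LP//.
by rewrite (le_trans zB)//; have := ler_norm B; lra.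
Qed.

Lemma henon_perturbation (B : R) n (e : R) : 0 < e -> exists2 a1 : R, 0 < a1 &
  forall a, modulus a < a1 -> forall v, modulus v.1 <= B -> modulus v.2 < r ->
    modulus ((iter n (henon p a) v).1 - piter p n v.1) < e /\
    modulus (iter n (henon p a) v).2 < r.
Proof.
elim: n e => [|n IH] e e0.
  by exists 1 => // a _ v _ v2; rewrite /= subrr modulus0.
have [M M0 MP] := poly_bound (iterp p n) B.
have [L L0 LP] := poly_lipschitz p (M + 1).
(* The bound 1 keeps the orbit in the ball of radius M + 1, where L is a Lipschitz constant of p; e
   / (2 L) makes the propagated error at most e / 2 and leaves e / 2 for a y. *)
pose e' := Num.min 1 (e / (2 * L)).
have e'0 : 0 < e' by rewrite lt_min ltr01 divr_gt0// mulr_gt0.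
have e'1 : e' <= 1 by rewrite ge_min lexx.
have e'L : e' <= e / (2 * L) by rewrite ge_min lexx orbT.
have [a1 a10 aP] := IH _ e'0.
pose m := Num.min a1 (Num.min (e / (2 * r)) (r / (M + 1))).
have M1 : 0 < M + 1 by rewrite addr_gt0.
exists m; first by rewrite !lt_min a10 !divr_gt0// mulr_gt0.
move=> a; rewrite !lt_min => /and3P[aa1 aer arM] v v1 v2.
have [H1 H2] := aP a aa1 v v1 v2.
rewrite iterS; set w := iter n _ v in H1 H2 *.
have pM : modulus (piter p n v.1) <= M by rewrite piterE; exact: MP.
have w1 : modulus w.1 <= M + 1.
  rewrite -(subrK (piter p n v.1) w.1) (le_trans (modulusD _ _))//; lra.
split; rewrite /henon /=.
  rewrite addrAC; apply: le_lt_trans (modulusD _ _) _; rewrite modulusM (splitr e).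
  apply: ler_ltD.
    apply: le_trans (LP _ _ w1 _) _; first by lra.
    apply: le_trans (_ : L * (e / (2 * L)) <= _).
      by rewrite ler_wpM2l ?(ltW L0)// (le_trans (ltW H1)).
    by rewrite le_eqVlt; apply/orP; left; apply/eqP; field; rewrite gt_eqF.
  apply: le_lt_trans (_ : modulus a * r < _).
    by rewrite ler_wpM2l ?modulus_ge0// ltW.
  by rewrite -ltr_pdivlMr// -mulrA -invfM.
rewrite modulusM (le_lt_trans (_ : _ <= modulus a * (M + 1)))//.
  by rewrite ler_wpM2l ?modulus_ge0.
by rewrite -ltr_pdivlMr.
Qed.

End HenonPerturbation.

(** * Continuity, invariance of K+ and J+, and escape for a Hénon map *)

Section HenonDynamics.
Context {R : realType} (p : {poly CC R}) (a : CC R).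
Implicit Types (z : CC R) (v w : CC R * CC R) (n : nat) (A : set (CC R * CC R)).

Lemma nbhs_modulus2 v A : nbhs v A <-> exists2 e : R, 0 < e &
  forall w, modulus (w.1 - v.1) < e -> modulus (w.2 - v.2) < e -> A w.
Proof.
split=> [[[A1 A2] [/= /nbhs_modulus[e1 e10 H1] /nbhs_modulus[e2 e20 H2]] HA]|[e e0 eA]].
  exists (Num.min e1 e2); first by rewrite lt_min e10.
  move=> w; rewrite !lt_min => /andP[w1 _] /andP[_ w2].
  by apply: HA; split; [exact: H1|exact: H2].
exists ([set x | modulus (x - v.1) < e], [set y | modulus (y - v.2) < e]).
  by split; apply/nbhs_modulus; exists e.
by move=> w [w1 w2]; exact: eA.
Qed.

Lemma continuous_henon : continuous (henon p a).
Proof.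
move=> v A /nbhs_modulus2[e e0 eA].
have e2 : 0 < e / 2 by rewrite divr_gt0.
have /cvg_modulus/(_ _ e2)/nbhs_modulus[k k0 kP] := continuous_hornerC p v.1.
have a1 : 0 < modulus a + 1 by rewrite ltr_wpDl// modulus_ge0.
apply/(nbhs_modulus2 v (henon p a @^-1` A)).
exists (Num.min k (e / 2 / (modulus a + 1))).
  by rewrite lt_min k0 divr_gt0.
move=> w; rewrite !lt_min => /andP[w1 w1'] /andP[_ w2].
have small z : modulus z < e / 2 / (modulus a + 1) -> modulus (a * z) < e / 2.
  move=> zs; rewrite modulusM (le_lt_trans (_ : _ <= (modulus a + 1) * modulus z))//.
    by rewrite ler_wpM2r ?modulus_ge0// lerDl.
  by rewrite mulrC -ltr_pdivlMr.
apply: eA; rewrite /henon /=.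
  have -> : p.[w.1] + a * w.2 - (p.[v.1] + a * v.2) = (p.[w.1] - p.[v.1]) + a * (w.2 - v.2) by ring.
  by rewrite (le_lt_trans (modulusD _ _))// (splitr e) ltrD ?small//; exact: kP.
by rewrite -mulrBr (lt_trans (small _ w1'))// ltr_pdivrMr// ltr_pMr// ltr1n.
Qed.

Lemma continuous_iter_henon n : continuous (iter n (henon p a)).
Proof.
elim: n => [|n IH] v; first exact: cvg_id.
by apply: (@continuous_comp _ _ _ (iter n (henon p a)) (henon p a));
  [exact: IH|exact: continuous_henon].
Qed.

Lemma Kplus_henon v : Kplus p a (henon p a v) <-> Kplus p a v.
Proof.
split=> [[M MP]|[M MP]]; last by exists M => n; rewrite -iterSr; exact: MP.
exists (Num.max M (Num.max (modulus v.1) (modulus v.2))) => -[|n].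
  by rewrite !le_max !lexx !orbT.
by rewrite iterSr !le_max; have [-> ->] := MP n.
Qed.

Lemma Kplus_iter n v : Kplus p a (iter n (henon p a) v) <-> Kplus p a v.
Proof. by elim: n => [//|n IH]; rewrite iterS Kplus_henon. Qed.

Lemma Jplus_henon v : Jplus p a v -> Jplus p a (henon p a v).
Proof.
move=> [cv iv]; split.
  move=> A /continuous_henon nA; have [w [Kw Aw]] := cv _ nA.
  by exists (henon p a w); split => //; exact/Kplus_henon.
move=> int; apply: iv.
have nK : nbhs v (henon p a @^-1` Kplus p a) by apply: continuous_henon; exact: int.
suff : nbhs v (Kplus p a) by [].
by apply: filterS nK => w /Kplus_henon.
Qed.

(** The cone |y| <= |x| beyond the escape radius is invariant, as the new second coordinate a x is
    at most |x|, and |x| at least doubles: 3 |x| - |a y| >= 2 |x|. *)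
Lemma henon_escape (r : R) v : modulus a <= 1 -> 0 < r ->
  (forall z, r <= modulus z -> 3 * modulus z <= modulus p.[z]) ->
  r < modulus v.1 -> modulus v.2 <= modulus v.1 -> ~ Kplus p a v.
Proof.
move=> a1 r0 rP v1 v2 [M MP].
have key n : 2 ^+ n * modulus v.1 <= modulus (iter n (henon p a) v).1 /\
    modulus (iter n (henon p a) v).2 <= modulus (iter n (henon p a) v).1.
  elim: n => [|n [IH1 IH2]]; first by rewrite expr0 mul1r.
  rewrite iterS; set w := iter n _ v in IH1 IH2 *.
  have rw : r <= modulus w.1.
    rewrite (le_trans _ IH1)// (le_trans (ltW v1))// ler_peMl ?modulus_ge0//.
    by rewrite exprn_ege1// ler1n.
  have aw z : modulus (a * z) <= modulus z by rewrite modulusM ler_piMl ?modulus_ge0.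
  have w1 : 2 * modulus w.1 <= modulus (henon p a w).1.
    rewrite /henon /=; have := modulusBl p.[w.1] (- (a * w.2)).
    rewrite opprK modulusN; have := aw w.2; have := rP _ rw; lra.
  have := modulus_ge0 w.1; have := aw w.1; rewrite [in X in _ -> _ -> X]exprS -mulrA.
  by rewrite /henon /= in w1 *; split; lra.
pose n := (Num.truncn (M / r)).+1.
have [] := MP n; have [+ _ + _] := key n.
have Mr : M / r < 2 ^+ n.
  apply: lt_trans (truncnS_gt _) _; rewrite -natrX ltr_nat; exact: ltn_expl.
move: Mr; rewrite ltr_pdivrMr// => Mr h1 h2.
have : 2 ^+ n * r <= 2 ^+ n * modulus v.1 by rewrite ler_wpM2l ?exprn_ge0// ltW.
lra.
Qed.

End HenonDynamics.

(** * Boundedness of U, and the position of J+ over U' *)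

Section FundamentalDomain.
Context {R : realType} (p : {poly CC R}) (psi chi : CC R -> CC R)
  (eps : CC R -> R) (N : nat) (Rad r : R).
Hypotheses (size_p : (2 < size p)%N) (psiP : bottcher p psi chi)
  (eps_trapping : trapping_radii p eps) (Rad_gt1 : 1 < Rad) (r0 : 0 < r).
Implicit Types (a z w : CC R) (v : CC R * CC R).

Definition escaping z : Prop := (~` filled_julia p) z /\ Rad <= modulus (chi z).

Lemma bottcher_iter n w : exterior w ->
  piter p n (psi w) = psi (w ^+ ((size p).-1 ^ n)).
Proof.
move=> w1; elim: n => [|n IH]; first by rewrite expn0 expr1.
have wn : exterior (w ^+ ((size p).-1 ^ n)).
  rewrite /exterior /= modulusX exprn_egt1 -?lt0n ?expn_gt0//.
  by case: (size p) size_p => [|[|m]].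
by rewrite piterS IH -(bottcher_conj psiP)// expnSr exprM.
Qed.

Lemma pow_large (x B : R) : 1 < x -> exists n, B < x ^+ n.
Proof.
move=> x1; have x10 : 0 < x - 1 by rewrite subr_gt0.
pose n := (Num.truncn (B / (x - 1))).+1; exists n.
have Bn : B < n%:R * (x - 1) by rewrite -ltr_pdivrMr// truncnS_gt.
apply: lt_le_trans Bn _; elim: n => [|n IH]; first by rewrite mul0r expr0.
rewrite exprS -natr1 mulrDl mul1r.
have xn : 1 <= x ^+ n by rewrite exprn_ege1// ltW.
have : (x - 1) * 1 <= (x - 1) * x ^+ n by rewrite ler_wpM2l// ltW.
lra.
Qed.

Lemma expn_ge_id d n : (1 < d)%N -> (n <= d ^ n)%N.
Proof. by move=> d1; exact/ltnW/ltn_expl. Qed.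

Lemma d_gt1 : (1 < (size p).-1)%N.
Proof. by case: (size p) size_p => [|[|[|m]]]. Qed.

(** The escape time is uniform because p acts on the Böttcher coordinate, of modulus at least Rad >
    1, as the power d. Near infinity |psi w| >= |w| / 2, whence the threshold 2 B. *)
Lemma escaping_piter (B : R) : exists n, forall z, escaping z -> B <= modulus (piter p n z).
Proof.
have half0 : 0 < 1 / 2 :> R by rewrite divr_gt0.
have [M MP] := bottcher_infty psiP half0.
have [n nP] := pow_large Rad (Num.max M (2 * B)) Rad_gt1.
exists n => z [zK zR]; have zE := bottcher_invK psiP zK.
have w1 := bottcher_inv_maps psiP zK.
rewrite -zE bottcher_iter//; set w := chi z ^+ _.
have mw : Num.max M (2 * B) < modulus w.
  apply: lt_le_trans nP _; rewrite modulusX.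
  apply: le_trans (_ : modulus (chi z) ^+ n <= _).
    by rewrite lerXn2r// nnegrE ?modulus_ge0// (le_trans ler01)// ltW.
  by rewrite ler_weXn2l ?expn_ge_id ?d_gt1//; exact: ltW.
move: mw; rewrite gt_max => /andP[/MP pw Bw].
have w0 : w != 0.
  rewrite /w expf_neq0// -modulus_gt0; exact: lt_trans ltr01 w1.
have mw0 : 0 < modulus w by rewrite modulus_gt0.
have : 1 / 2 <= modulus (psi w / w).
  have := modulus_triB 1 (psi w / w) 0.
  rewrite !subr0 modulus1 (modulusB 1); lra.
by rewrite modulusM modulusV ler_pdivlMr// => H; lra.
Qed.

(** The normalization controls psi only near infinity, not on all of 1 < |w| < Rad. A point off the
    filled Julia set is therefore followed until its coordinate first exceeds L; it is then at most
    L^d, so the iterate has modulus at most 2 L^d, and a point beyond the escape radius is smaller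
    than its iterates. *)
Lemma domU_bounded : exists2 M : R, 0 < M &
  forall z, domU p eps N chi Rad z -> modulus z <= M.
Proof.
have [rK rK0 rKP] := filled_julia_bounded p size_p.
have [r1 r10 r1P] := poly_escape p size_p.
have [M MP] := bottcher_infty psiP (@ltr01 R).
pose L := Num.max M Rad.
have ML : M <= L by rewrite le_max lexx.
have RL : Rad <= L by rewrite le_max lexx orbT.
have L0 : 0 < L by rewrite (lt_le_trans _ RL)// (lt_trans ltr01).
have Lp : 0 <= L ^+ (size p).-1 by rewrite exprn_ge0// ltW.
exists (rK + r1 + 2 * L ^+ (size p).-1); first by rewrite ltr_wpDr ?mulr_ge0// addr_gt0.
move=> z /not_orP[_ zU].
have [/rKP zK|zK] := pselect (filled_julia p z); first by lra.
have zR : modulus (chi z) < Rad.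
  by rewrite ltNge; apply/negP => zR; apply: zU.
have w1 := bottcher_inv_maps psiP zK.
have [z1|z1] := ltP (modulus z) r1; first by lra.
have ex : exists n, L < modulus (chi z ^+ ((size p).-1 ^ n)).
  have [n nP] := pow_large (modulus (chi z)) L w1; exists n.
  rewrite modulusX (lt_le_trans nP)//.
  by rewrite ler_weXn2l ?expn_ge_id ?d_gt1//; exact: ltW.
have [n nP nmin] := ex_minnP ex; case: n nP nmin => [|n] nP nmin.
  by move: nP; rewrite expn0 expr1; lra.
have wn : modulus (chi z ^+ ((size p).-1 ^ n)) <= L.
  by rewrite leNgt; apply/negP => /nmin; rewrite ltnn.
set w := chi z ^+ ((size p).-1 ^ n.+1) in nP.
have wL : modulus w <= L ^+ (size p).-1.
  rewrite /w expnSr exprM modulusX lerXn2r// nnegrE ?modulus_ge0//; exact: ltW.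
have pw : modulus (psi w) <= 2 * modulus w.
  have /MP pw : M < modulus w by lra.
  have mw0 : 0 < modulus w by lra.
  have : modulus (psi w / w) <= 2.
    have := modulusBl (psi w / w) 1; rewrite modulus1; lra.
  by rewrite modulusM modulusV ler_pdivrMr.
have := escape_piter _ _ _ r10 r1P z1 n.+1.
rewrite -{2}(bottcher_invK psiP zK) bottcher_iter// -/w.
have : modulus z <= 3 ^+ n.+1 * modulus z.
  by rewrite ler_peMl ?modulus_ge0// exprn_ege1// ler1n.
lra.
Qed.

Lemma nbhs_not_Kplus a n (r1 : R) v : modulus a <= 1 -> 0 < r1 ->
  (forall z, r1 <= modulus z -> 3 * modulus z <= modulus p.[z]) ->
  r1 < modulus (iter n (henon p a) v).1 -> modulus (iter n (henon p a) v).2 < r1 ->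
  nbhs v (~` Kplus p a).
Proof.
move=> a1 r10 r1P v1 v2.
have nb : nbhs (iter n (henon p a) v) (~` Kplus p a).
  apply/nbhs_modulus2.
  set w := iter n (henon p a) v in v1 v2 *.
  exists (Num.min (modulus w.1 - r1) (r1 - modulus w.2)).
    by rewrite lt_min !subr_gt0 v1.
  move=> u; rewrite !lt_min => /andP[u1 _] /andP[_ u2].
  have := modulusBl w.1 u.1; rewrite modulusB => h1.
  have := modulusBl u.2 w.2 => h2.
  by apply: (henon_escape _ _ r1) => //; lra.
have nK : nbhs v (iter n (henon p a) @^-1` (~` Kplus p a)).
  by apply: continuous_iter_henon; exact: nb.
by apply: filterS nK => u /= uK /(Kplus_iter p a n).
Qed.

Lemma escaping_henon : exists2 a1 : R, 0 < a1 & forall a, modulus a < a1 ->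
  forall v, escaping p.[v.1] -> modulus v.2 < r -> nbhs v (~` Kplus p a).
Proof.
have [r2 r20 r2P] := poly_escape p size_p; pose r1 := r2 + r.
have rpos : 0 < r by exact: r0.
have r10 : 0 < r1 by rewrite addr_gt0.
have r1P z : r1 <= modulus z -> 3 * modulus z <= modulus p.[z].
  by move=> rz; apply: r2P; rewrite /r1 in rz; lra.
have [n nP] := escaping_piter (r1 + 1).
(* One more step than [n], since p x and not x is in the escaping region; the shadowing error 1 is
   paid for by the threshold r1 + 1. Points with |x| > r1 + 1, where shadowing is not uniform,
   escape at once. *)
have [a1 a10 aP] := henon_perturbation p r r0 (r1 + 1) n.+1 1 ltr01.
exists (Num.min a1 1); first by rewrite lt_min a10 ltr01.
move=> a; rewrite lt_min => /andP[aa1 /ltW a1'] v ve v2.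
have [v1|v1] := leP (modulus v.1) (r1 + 1); last first.
  by apply: (nbhs_not_Kplus a 0 r1) => //=; rewrite ?/r1; rewrite /r1 in v1; lra.
have [H1 H2] := aP a aa1 v v1 v2.
apply: (nbhs_not_Kplus a n.+1 r1) => //; last by rewrite /r1; lra.
have := nP _ ve; rewrite -piterSr => H3.
have := modulusBl (piter p n.+1 v.1) (iter n.+1 (henon p a) v).1.
rewrite modulusB; lra.
Qed.

Lemma Delta_bounded : exists2 M : R, 0 < M &
  forall z, Delta p eps z -> modulus z <= M.
Proof.
have [s sP] := attracting_finite p size_p eps eps_trapping.
pose M := \big[Num.max/1]_(z <- s) (modulus z + eps z).
exists M; first by rewrite (lt_le_trans ltr01)// bigmax_ge_id.
move=> w [z az zw]; apply: le_trans (_ : modulus z + eps z <= _).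
  have := modulusBl w z; rewrite /disc /= in zw; lra.
by apply: le_bigmax_seq (sP _ az) _.
Qed.

(** The point p^(N+1) x is only in the closure of Delta; one further step puts it in Delta with
    margin e, hence N + 2 steps. The same margin absorbs the shadowing error and, later, each term a
    y with |a| r < e, so that the orbit stays over Delta. *)
Lemma attracted_henon : exists2 a1 : R, 0 < a1 & forall a, modulus a < a1 ->
  forall v, closure (piter p N @^-1` Delta p eps) p.[v.1] -> modulus v.2 < r ->
  nbhs v (Kplus p a).
Proof.
have [e e0 eP] := Delta_margin p size_p eps eps_trapping.
have [M M0 MP] := Delta_bounded.
have [r2 r20 r2P] := poly_escape p size_p.
have [a1 a10 aP] := henon_perturbation p r r0 (r2 + M) N.+2 e e0.
exists (Num.min a1 (Num.min (e / r) (r / M))).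
  by rewrite !lt_min a10 !divr_gt0.
move=> a; rewrite !lt_min => /and3P[aa1 aer arM].
have trap n (w : CC R * CC R) : Delta p eps w.1 -> modulus w.2 < r ->
    Delta p eps (iter n (henon p a) w).1 /\ modulus (iter n (henon p a) w).2 < r.
  move=> w1 w2; elim: n => [//|n [IH1 IH2]].
  rewrite iterS; set u := iter n _ w in IH1 IH2 *; split.
    apply: (eP u.1); first exact: subset_closure.
    rewrite /henon /= addrC addKr modulusM.
    apply: le_lt_trans (_ : modulus a * r < _); first by rewrite ler_wpM2l ?modulus_ge0// ltW.
    by rewrite -ltr_pdivlMr.
  rewrite /henon /= modulusM (le_lt_trans (_ : _ <= modulus a * M))//.
    by rewrite ler_wpM2l ?modulus_ge0 ?MP.
  by rewrite -ltr_pdivlMr.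
have TK (w : CC R * CC R) : Delta p eps w.1 -> modulus w.2 < r -> Kplus p a w.
  move=> w1 w2; exists (Num.max M r) => n; have [/MP u1 u2] := trap n w w1 w2.
  by rewrite !le_max u1 (ltW u2) orbT.
move=> v vD v2.
have cD : closure (Delta p eps) (piter p N.+1 v.1).
  rewrite piterSr.
  have := closure_image (piter p N) _ _ (continuous_piter p N p.[v.1]) vD.
  by apply: closure_subset => _ [u uD <-].
have v1 : modulus v.1 <= r2 + M.
  have [|v1] := ltP (modulus v.1) r2; first by lra.
  have := escape_piter _ _ _ r20 r2P v1 N.+2.
  have : modulus v.1 <= 3 ^+ N.+2 * modulus v.1.
    by rewrite ler_peMl ?modulus_ge0// exprn_ege1// ler1n.
  have : modulus (piter p N.+2 v.1) <= M.
    by apply: MP; apply: (eP _ _ cD); rewrite -piterS subrr modulus0.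
  lra.
have [H1 H2] := aP a aa1 v v1 v2.
have nb : nbhs (iter N.+2 (henon p a) v) (Kplus p a).
  apply/nbhs_modulus2; set w := iter N.+2 (henon p a) v in H1 H2 *.
  pose k := Num.min (e - modulus (w.1 - piter p N.+2 v.1)) (r - modulus w.2).
  exists k; first by rewrite lt_min !subr_gt0 H1 H2.
  move=> u; rewrite !lt_min => /andP[u1 _] /andP[_ u2]; apply: TK.
    apply: (eP _ _ cD); rewrite -piterS.
    rewrite (le_lt_trans (modulus_triB u.1 w.1 _))//; lra.
  have := modulusBl u.2 w.2; lra.
have nK : nbhs v (iter N.+2 (henon p a) @^-1` Kplus p a).
  by apply: continuous_iter_henon; exact: nb.
by apply: filterS nK => u /(Kplus_iter p a N.+2).
Qed.

(* Off [U'] the map is either attracted or escaping, both open conditions. *)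
Lemma Jplus_domU' : exists2 a1 : R, 0 < a1 & forall a, modulus a < a1 ->
  forall v, Jplus p a v -> modulus v.2 < r -> domU' p eps N chi Rad v.1.
Proof.
have [a1 a10 H1] := escaping_henon; have [a2 a20 H2] := attracted_henon.
exists (Num.min a1 a2); first by rewrite lt_min a10.
move=> a; rewrite lt_min => /andP[aa1 aa2] v [cv iv] v2 [cD|esc].
  by apply: iv; exact: H2.
by have [w [wK /(_ wK)]] := cv _ (H1 a aa1 v esc v2).
Qed.

End FundamentalDomain.

(** * Iterates of the graph transform *)

Lemma modulus_expi {R : realType} (t : R) : modulus (expi t) = 1.
Proof. by rewrite /modulus /= cos2Dsin2 sqrtr1. Qed.

Section GraphTransform.
Context {R : realType} (p : {poly CC R}) (psi chi : CC R -> CC R)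
  (eps : CC R -> R) (N : nat) (Rad r : R) (rho : CC R -> R) (a : CC R)
  (f h : nat -> R -> CC R -> CC R).
Hypotheses (size_p : (2 < size p)%N) (psiP : bottcher p psi chi)
  (Rad_gt1 : 1 < Rad).
Hypothesis fP : graph_transform_iterates p a psi Rad
  (domU' p eps N chi Rad) rho r f h.
Implicit Types (z w : CC R) (t : R).

(** The tangent vector with eta = 1 shows that the derivative has modulus below 1. The index starts
    at 1: the disks of [f 0] lie outside [U'], so they are not vertical-like. *)
Lemma graph_transform_lipschitz n t z w : disc 0 r z -> disc 0 r w ->
  modulus (f n.+1 t z - f n.+1 t w) <= 2 * modulus (z - w).
Proof.
have [hol _ tang] := gt_vertical fP n t.
apply: (lipschitz_disc _ _ hol) => v vr.
have [||+ _] := tang v vr (cderiv (f n.+1 t) v) 1; first by rewrite mulr1.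
  by apply/eqP => -[_ /eqP]; rewrite oner_eq0.
by rewrite modulus1 => /ltW.
Qed.

(** The functional equation of the graph transform: a component of the preimage lies in the
    preimage. The first step is governed by [gt_f1], the later ones by [gt_f_pullback]. *)
Lemma graph_transform_pullback n t z : disc 0 r z ->
  exists w, [/\ disc 0 r w, w = a * f n.+1 t z &
    f n ((size p).-1%:R * t) w = p.[f n.+1 t z] + a * z].
Proof.
move=> zr.
have : graph r (f n.+1 t) (f n.+1 t z, z) by exists z.
have gsub v : graph r (f n.+1 t) `<=` connected_component
    (henon p a @^-1` graph r (f n ((size p).-1%:R * t)) `&`
     domV (domU' p eps N chi Rad) r) v ->
  graph r (f n.+1 t) `<=` henon p a @^-1` graph r (f n ((size p).-1%:R * t)).
  by move=> sub u /sub/connected_component_sub[].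
have sub : graph r (f n.+1 t) `<=` henon p a @^-1` graph r (f n ((size p).-1%:R * t)).
  case: n {zr} gsub => [|n] gsub.
    by have [_ E] := gt_f1 fP t; apply: (gsub (gamma p psi Rad 1 t, 0)); rewrite E.
  by have [v [_ E]] := gt_f_pullback fP n t; apply: (gsub v); rewrite E.
by move=> /sub[w wr [fw wE]]; exists w.
Qed.

(** p sends the outer boundary of V to the equipotential |chi| = Rad exactly, which the non-strict
    inequality in [escaping] includes. *)
Lemma gamma_escaping t : escaping p chi Rad p.[gamma p psi Rad 0 t].
Proof.
have d0 : (0 < (size p).-1)%N by case: (size p) size_p => [|[|m]].
rewrite /gamma expn1; set w := _ * _.
have mw : modulus w = Rad `^ ((size p).-1%:R^-1).
  by rewrite modulusM modulus_expi mulr1 modulus_tc ger0_norm// powR_ge0.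
have Rad0 : 0 <= Rad by rewrite (le_trans ler01)// ltW.
have wd : modulus (w ^+ (size p).-1) = Rad.
  rewrite modulusX mw -powR_mulrn ?powR_ge0// -powRrM mulVf ?powRr1//.
  by rewrite pnatr_eq0 -lt0n.
have w1 : exterior w.
  rewrite /exterior /= ltNge; apply/negP => w1.
  have : modulus w ^+ (size p).-1 <= 1 by rewrite exprn_ile1// modulus_ge0.
  by rewrite -modulusX wd leNgt Rad_gt1.
rewrite -(bottcher_conj psiP)//.
have wd1 : exterior (w ^+ (size p).-1) by rewrite /exterior /= wd.
split; first exact: (bottcher_maps psiP).
by rewrite (bottcherK psiP)// wd.
Qed.

Lemma graph_transform_not_Kplus :
  (forall v, escaping p chi Rad p.[v.1] -> modulus v.2 < r -> ~ Kplus p a v) ->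
  forall n t z, disc 0 r z -> ~ Kplus p a (f n t z, z).
Proof.
move=> esc; elim=> [|n IH] t z zr.
  apply: esc; last by move: zr; rewrite /disc /= subr0.
  by rewrite /= (gt_f0 fP)//; exact: gamma_escaping.
have [w [wr wE fw]] := graph_transform_pullback n t z zr.
by move=> /Kplus_henon; rewrite /henon /= -fw -wE; exact: IH.
Qed.

End GraphTransform.

Theorem theorem5p1 (R : realType) (d : nat) (p : {poly CC R})
  (p_monic : p \is monic) (size_p : size p = d.+1) (d_ge2 : (2 <= d)%N)
  (p_hyperbolic : hyperbolic p) (julia_connected : connected (julia p))
  (psi chi : CC R -> CC R) (psi_bottcher : bottcher p psi chi)
  (eps : CC R -> R) (eps_trapping : trapping_radii p eps)
  (N : nat) (N_minimal : minimal_level p eps N)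
  (Rad r : R) (Rad_gt1 : 1 < Rad) (r_gt3 : 3 < r)
  (circle_subU' : [set y | modulus y = r] `<=` domU' p eps N chi Rad)
  (rho : CC R -> R) (rho_poincare : poincare_density (domU p eps N chi Rad) rho) :
  exists2 a0 : R, 0 < a0 &
    forall a : CC R, 0 < modulus a < a0 ->
    let U := domU p eps N chi Rad in
    let U' := domU' p eps N chi Rad in
    let JV := Jplus p a `&` domV U' r in
    let circle_disc := [set q : R * CC R | disc 0 r q.2] in
    henon p a @` JV `<=` JV /\
    forall phi : R -> CC R -> CC R,
      graph_transform_fixed_point p a psi Rad U U' rho r phi ->
      [/\ fstar phi @` circle_disc `<=` JV,
          sigma d a phi @` circle_disc `<=` circle_disc &
          forall q, circle_disc q ->
            henon p a (fstar phi q) = fstar phi (sigma d a phi q)].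
Proof.
have sp : (2 < size p)%N by rewrite size_p ltnS.
have r0 : 0 < r by rewrite (lt_trans _ r_gt3).
have [M1 M10 UM1] := domU_bounded p psi chi eps N Rad sp psi_bottcher Rad_gt1.
have [r1 r10 r1P] := poly_escape p sp.
pose M := M1 + r1.
have M0 : 0 < M by rewrite addr_gt0.
have UM z : domU p eps N chi Rad z -> modulus z <= M.
  by move=> /UM1 zM; rewrite /M; lra.
(* A point of [U'] either has modulus below r1 or satisfies 3 |z| <= |p z| <= M1. *)
have U'M z : domU' p eps N chi Rad z -> modulus z <= M.
  move=> /UM1 zM; have [|/r1P] := ltP (modulus z) r1; rewrite /M; have := modulus_ge0 z; lra.
have [a1 a10 escP] := escaping_henon p psi chi Rad r sp psi_bottcher Rad_gt1 r0.
have [a2 a20 JU'] := Jplus_domU' p psi chi eps N Rad r sp psi_bottcher eps_trapping Rad_gt1 r0.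
(* |a| <= 1 makes multiplication by a nonexpanding, |a| < r / M keeps a x in the disc of radius r,
   and the other two bounds locate J+ and the escaping points. *)
exists (Num.min (Num.min 1 (r / M)) (Num.min a1 a2)).
  by rewrite !lt_min ltr01 divr_gt0//= a10.
move=> a /andP[a0]; rewrite !lt_min => /andP[/andP[/ltW a_1 arM] /andP[aa1 aa2]].
move=> U U' JV circle_disc.
have disc_a z : modulus z <= M -> disc 0 r (a * z).
  move=> zM; rewrite /disc /= subr0 modulusM.
  apply: le_lt_trans (_ : modulus a * M < _); first by rewrite ler_wpM2l ?modulus_ge0.
  by rewrite -ltr_pdivlMr.
have disc_lt z : disc 0 r z -> modulus z < r by rewrite /disc /= subr0.
have JVE v : Jplus p a v -> disc 0 r v.2 -> JV v.
  by move=> Jv vr; split => //; split => //; apply: JU' Jv _ => //; exact: disc_lt.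
split=> [_ [v [Jv [v1 v2]] <-]|phi [_ phiU [f [h [fP fphi]]]]].
  by apply: JVE; [exact: Jplus_henon|exact/disc_a/U'M].
have cvgf := family_dist_cvg _ _ _ _ _ _ M0 UM rho_poincare fphi.
have phiM t z : disc 0 r z -> modulus (phi t z) <= M by move=> /(phiU t)/UM.
have sig t z : disc 0 r z -> disc 0 r (a * phi t z) by move=> /(phiM t)/disc_a.
have eqn t z : disc 0 r z -> p.[phi t z] + a * z = phi (d%:R * t) (a * phi t z).
  move=> zr; apply/eqP; rewrite -subr_eq0; apply/eqP/modulus_eq0.
  apply/eqP; rewrite eq_le modulus_ge0 andbT; apply/ler_addgt0Pr => e e0; rewrite add0r.
  (* One quarter for continuity of p, two for the Lipschitz constant 2 in comparing the points [w]
     and a phi, one for the convergence at d t. *)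
  have e4 : 0 < e / 4 by rewrite divr_gt0.
  have /cvg_modulus/(_ _ e4)/nbhs_modulus[k k0 kP] := continuous_hornerC p (phi t z).
  pose k' := Num.min k (e / 4); have k'0 : 0 < k' by rewrite lt_min k0.
  have [n nP] := cvgf _ k'0.
  (* The index is [n.+2] so that its image disk, of index [n.+1], is vertical-like and thus
     Lipschitz. *)
  have := nP n.+2 t z (leqW (leqnSn n)) zr; rewrite lt_min => /andP[h1 h2].
  have := nP n.+1 (d%:R * t) _ (leqnSn n) (sig t z zr); rewrite lt_min => /andP[_ h3].
  have [w [wr wE fw]] := graph_transform_pullback _ _ _ _ _ _ _ _ _ _ _ fP n.+1 t z zr.
  rewrite size_p /= in fw.
  have lip := graph_transform_lipschitz _ _ _ _ _ _ _ _ _ _ _ fP n (d%:R * t) w _ wr (sig t z zr).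
  have wphi : modulus (w - a * phi t z) <= modulus (f n.+2 t z - phi t z).
    by rewrite wE -mulrBr modulusM ler_piMl ?modulus_ge0.
  have h4 := kP _ h1.
  have -> : p.[phi t z] + a * z - phi (d%:R * t) (a * phi t z) =
      - (p.[f n.+2 t z] - p.[phi t z]) +
      ((f n.+1 (d%:R * t) w - f n.+1 (d%:R * t) (a * phi t z)) +
       (f n.+1 (d%:R * t) (a * phi t z) - phi (d%:R * t) (a * phi t z))).
    by rewrite fw; ring.
  apply: le_trans (modulusD _ _) _; rewrite modulusN.
  have := modulusD (f n.+1 (d%:R * t) w - f n.+1 (d%:R * t) (a * phi t z))
       (f n.+1 (d%:R * t) (a * phi t z) - phi (d%:R * t) (a * phi t z)).
  lra.
have heq q : circle_disc q -> henon p a (fstar phi q) = fstar phi (sigma d a phi q).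
  by case: q => t z zr; rewrite /henon /fstar /sigma /= eqn.
split; last exact: heq.
  move=> _ [[t z] zr <-]; apply: JVE => //; split.
    apply: subset_closure; exists (Num.max M r) => n.
    have it q : circle_disc q -> exists2 q', circle_disc q' &
        iter n (henon p a) (fstar phi q) = fstar phi q'.
      elim: n q => [|n IH] q qr; first by exists q.
      rewrite iterSr heq//; apply: IH; exact: sig.
    have [[t' z'] zr' ->] := it (t, z) zr.
    by rewrite /fstar /= !le_max phiM// (ltW (disc_lt _ zr')) orbT.
  move=> int.
  have /nbhs_modulus2[e e0 eP] : nbhs (fstar phi (t, z)) (Kplus p a) by exact: int.
  have [n nP] := cvgf _ e0.
  have esc v : escaping p chi Rad p.[v.1] -> modulus v.2 < r -> ~ Kplus p a v.
    by move=> v1 v2; exact: nbhs_singleton (escP a aa1 v v1 v2).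
  apply: (graph_transform_not_Kplus _ _ _ _ _ _ _ _ _ _ _ sp psi_bottcher Rad_gt1 fP esc n t z zr).
  apply: eP => /=; first exact: nP.
  by rewrite subrr modulus0.
by move=> _ [[t z] zr <-]; exact: sig.
Qed.
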